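(* Let $P\in\mathbb Q[x_1,x_2,\dots]$. (i) There are rational numbers $d_\nu$, independent of $n$ and indexed by partitions $\nu$ with $|\nu|\le\deg(P)$, such that for all $n\ge2\deg(P)$ the polynomial character on $S_n$ is $\chi_P=\sum_\nu d_\nu\chi^{(n-|\nu|,\nu)}$. (ii) If $\chi=\sum_\mu c_\mu\chi^\mu$ is a finite integer combination of irreducible characters of symmetric groups in which every $\mu$ with $c_\mu\ne0$ satisfies $\mu_1\le b$, then $\langle\chi_P,M_n(\chi)\rangle_{S_n}$ is constant as a function of $n$ for $n\ge\max\{2\deg(P),\deg(P)+b\}$.
   Context: $\chi_P$ is the class function on $S_n$ with $\chi_P(w)=P(m_1,m_2,\dots)$ when $w$ has $m_j$ cycles of length $j$; $\deg(P)$ is computed with $\deg(x_j)=j$. $(n-|\nu|,\nu)$ denotes the partition $(n-|\nu|,\nu_1,\nu_2,\dots)$. For a character $\chi$ of $S_m$, $M_n(\chi)=(\chi\otimes\mathbf 1_{S_{n-m}})\uparrow_{S_m\times S_{n-m}}^{S_n}$ for $n\ge m$ and $0$ otherwise, extended linearly. $\langle\cdot,\cdot\rangle_{S_n}$ is the standard inner product of class functions. *)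

(* Defs.v *)
From HB Require Import structures.
From mathcomp Require Import all_boot all_order all_algebra all_fingroup.
Set Implicit Arguments. Unset Strict Implicit. Unset Printing Implicit Defensive.
Import Order.TTheory GRing.Theory Num.Theory.
Local Open Scope ring_scope.

(* ---------- Polynomials in Q[x_1, ..., x_K] ------------------------------
   A polynomial in finitely many of the variables x_1, x_2, ... is given by
   K : nat and a finite formal sum P : seq (rat * K.-tuple nat); the term
   (c, e) stands for c * x_1^(e_0) * ... * x_K^(e_(K-1)).  All notions below
   (coefficients, weighted degree, evaluation) are invariant under the usual
   identification of formal sums. *)
Definition ratpoly (K : nat) := seq (rat * K.-tuple nat).

Definition qcoef K (P : ratpoly K) (e : K.-tuple nat) : rat :=
  \sum_(t <- P | t.2 == e) t.1.

Definition mweight K (e : K.-tuple nat) : nat :=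
  (\sum_(i < K) i.+1 * tnth e i)%N.

(* weighted degree of P (0 for the zero polynomial) *)
Definition qdeg K (P : ratpoly K) : nat := (
  \max_(t <- P | qcoef P t.2 != 0%R) mweight t.2)%N.

Definition cyc_count (T : finType) (w : {perm T}) (j : nat) : nat :=
  #|[set C in porbits w | #|C| == j]|.

Definition chiP K (P : ratpoly K) n (w : {perm 'I_n}) : rat :=
  \sum_(t <- P) t.1 * \prod_(i < K) (cyc_count w i.+1)%:R ^+ tnth t.2 i.

Definition ctype_on (T : finType) (w : {perm T}) (A : {set T}) : seq nat :=
  [seq #|(C : {set T})| | C <- enum [set C in porbits w | C \subset A]].

Definition ctype (T : finType) (w : {perm T}) : seq nat := ctype_on w setT.

Definition is_partition (l : seq nat) : bool :=
  sorted geq l && all (fun x => 0 < x)%N l.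

(* ---------- Irreducible characters chi^lambda ----------
   Permutation character of a Young subgroup with block sizes a_0..a_(l-1),
   evaluated at an element of cycle type rho: the number of ways to
   distribute the cycles into the blocks with the prescribed block sizes
   (0 if some a_i is negative). *)
Definition perm_char (l : nat) (a : 'I_l -> int) (rho : seq nat) : nat :=
  #|[set f : {ffun 'I_(size rho) -> 'I_l} |
      [forall i, ((\sum_(j | f j == i) nth 0%N rho j)%N)%:Z == a i]]|.

(* chi^lambda on cycle type rho, by the Jacobi-Trudi / Frobenius
   determinantal formula chi^lambda = det( pi_(lambda_i - i + j) ). *)
Definition irr_char (lam : seq nat) (rho : seq nat) : int :=
  \sum_(s : 'S_(size lam))
     (-1) ^+ s *
     (perm_char (fun i : 'I_(size lam) =>
                   (nth 0%N lam i)%:Z - (i : nat)%:Z + (s i : nat)%:Z) rho)%:Z.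

Definition chi (lam : seq nat) n (w : {perm 'I_n}) : rat :=
  (irr_char lam (ctype w))%:~R.

(* ---------- M_n(chi^mu) = Ind_{S_m x S_(n-m)}^{S_n} (chi^mu (x) 1) ---------- *)
Definition young_set n m : {set 'I_n} := [set i : 'I_n | (i < m)%N].

(* S_m x S_(n-m) inside S_n: permutations stabilising {0,..,m-1} *)
Definition young_sub n m : {set {perm 'I_n}} :=
  [set h : {perm 'I_n} | h @: young_set n m == young_set n m].

(* (chi^mu (x) 1)(h): chi^mu applied to the restriction of h to {0..m-1} *)
Definition Mn (mu : seq nat) n (w : {perm 'I_n}) : rat :=
  let m := sumn mu in
  if (m <= n)%N then
    #|young_sub n m|%:R^-1 *
    \sum_(x : {perm 'I_n})
       (if (w ^ x)%g \in young_sub n m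
        then (irr_char mu (ctype_on (w ^ x)%g (young_set n m)))%:~R
        else 0)
  else 0.

Definition Mn_lin (S : seq (seq nat)) (c : seq nat -> int) n
    (w : {perm 'I_n}) : rat :=
  \sum_(mu <- S) (c mu)%:~R * Mn mu w.

Definition cfdotS n (f g : {perm 'I_n} -> rat) : rat :=
  (n`!)%:R^-1 * \sum_(w : {perm 'I_n}) f w * g w.

(* Main.v *)
(* Evaluate class functions on cycle types.  For a list [b], let [pack b] count the
   ways of grouping some of the cycles into disjoint blocks of sizes [b].  As a
   function on [S_n] it is the permutation character of the Young subgroup with
   block sizes [(n - |b|, b)], and by Newton's identities the functions [pack b]
   with [|b| <= deg P] span the polynomial characters of degree at most [deg P].
   (i) The Jacobi-Trudi determinant of [(n - |nu|, nu)] is [pack nu] plus a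
   combination, independent of [n], of functions [pack b] whose composition
   [(N - |b|, b)], for a fixed [N >= 2 deg P], has a larger sum of squares; this
   triangular system can be inverted.
   (ii) [M_n(chi^mu)] is an alternating sum of permutation characters
   [(n - m, mu_j - j + s(j))].  By Burnside's lemma its product with [pack b]
   counts nonnegative integer matrices [B] with row sums at most [b], column sums
   at most [mu_j - j + s(j)] and [m - |B| <= n - |b|].  Only the last condition
   depends on [n]; when it fails, [m - |B|] exceeds [mu_1], and then the alternating
   sum over [s] vanishes for this [B]. *)
Require Import Defs.
From HB Require Import structures.
From mathcomp Require Import all_boot all_order all_algebra all_fingroup.
From mathcomp Require Import zify ring.
Set Implicit Arguments. Unset Strict Implicit. Unset Printing Implicit Defensive.
Import Order.TTheory GRing.Theory Num.Theory.
Local Open Scope ring_scope.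

(** * Packing parts into blocks *)

(** Entries are integers so that an overfilled block needs no separate test: it turns negative,
    stays negative, and admits no packing ([packings_neg]). *)
Definition lower (b : seq int) (i c : nat) : seq int :=
  set_nth 0 b i (nth 0 b i - c%:Z).

(** Parts may stay unpacked. For positive parts this is the pairing of the power sum p_rho with h_b
    times the sum of all h_k. *)
Fixpoint packings (b : seq int) (rho : seq nat) : rat :=
  if rho is c :: rho' then
    packings b rho' + \sum_(i < size b) packings (lower b i c) rho'
  else (all (pred1 0) b)%:R.

(* Counts packings together with a further part, equal to [j], set aside: the
   product [p_j h_b] of symmetric functions. *)
Fixpoint marked (j : nat) (b : seq int) (rho : seq nat) : rat :=
  if rho is c :: rho' then
    (c == j)%:R * packings b rho' + marked j b rho' +
      \sum_(i < size b) marked j (lower b i c) rho'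
  else 0.

Lemma size_lower b i c : (i < size b)%N -> size (lower b i c) = size b.
Proof. by move=> ib; rewrite size_set_nth; lia. Qed.

Lemma nth_lower b i c k :
  nth 0 (lower b i c) k = nth 0 b k - (if k == i then c%:Z else 0).
Proof. by rewrite nth_set_nth /=; case: eqP => [->|_]; rewrite ?subr0. Qed.

Lemma lowerC b i j c e : (i < size b)%N -> (j < size b)%N ->
  lower (lower b i c) j e = lower (lower b j e) i c.
Proof.
move=> ib jb; apply: (@eq_from_nth _ 0); first by rewrite !size_lower ?size_lower.
by move=> k _; rewrite !nth_lower; lia.
Qed.

Lemma big_lower_cons (F : seq int -> rat) x b c :
  \sum_(i < size (x :: b)) F (lower (x :: b) i c) =
  F ((x - c%:Z) :: b) + \sum_(i < size b) F (x :: lower b i c).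
Proof. by rewrite /= big_ord_recl. Qed.

Lemma has_neg_lower b i c :
  has (fun x => x < 0) b -> has (fun x => x < 0) (lower b i c).
Proof.
move=> /(has_nthP 0)[k kb neg]; apply/(has_nthP 0); exists k.
  by rewrite size_set_nth; lia.
by rewrite nth_lower; apply: le_lt_trans neg; rewrite gerBl; case: ifP.
Qed.

Lemma packings_neg b rho : has (fun x => x < 0) b -> packings b rho = 0.
Proof.
elim: rho b => [|c rho IH] b neg /=.
  case: allP => // b0; have /hasP[x /b0/= /eqP->] := neg; by rewrite ltxx.
by rewrite IH // big1 ?addr0 // => i _; rewrite IH // has_neg_lower.
Qed.

Lemma marked_neg j b rho : has (fun x => x < 0) b -> marked j b rho = 0.
Proof.
elim: rho b => [|c rho IH] b neg //=.
rewrite IH // packings_neg // mulr0 !add0r big1 // => i _.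
by rewrite IH // has_neg_lower.
Qed.

Lemma packings_nil rho : packings [::] rho = 1.
Proof. by elim: rho => [|c rho IH] //=; rewrite IH big_ord0 addr0. Qed.

(** Positivity matters here: a part of length 0 could also be placed in the empty block. *)
Lemma packings_cons0 b rho : all (leq 1) rho ->
  packings (0 :: b) rho = packings b rho.
Proof.
elim: rho b => [|c rho IH] b //= /andP[c0 rho0].
rewrite (big_lower_cons (fun b => packings b rho)) IH //.
rewrite [packings (_ - _ :: _) _]packings_neg /=; last by apply/orP; left; lia.
by rewrite add0r; congr (_ + _); apply: eq_bigr => i _; rewrite IH.
Qed.

Lemma marked_cons0 j b rho : all (leq 1) rho ->
  marked j (0 :: b) rho = marked j b rho.
Proof.
elim: rho b => [|c rho IH] b //= /andP[c0 rho0].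
rewrite (big_lower_cons (fun b => marked j b rho)) IH // packings_cons0 //.
rewrite [marked _ (_ - _ :: _) _]marked_neg /=; last by apply/orP; left; lia.
by rewrite add0r; congr (_ + _); apply: eq_bigr => i _; rewrite IH.
Qed.

(** Choose a part equal to [j] in a packing. Either it is unpacked, and setting it aside leaves the
    blocks unchanged, or it lies in some block [i], and setting it aside lowers that block by
    [j]. *)
Lemma count_packings j b rho :
  (count_mem j rho)%:R * packings b rho =
  marked j b rho + \sum_(i < size b) marked j (lower b i j) rho.
Proof.
elim: rho b => [|c rho IH] b /=.
  by rewrite mul0r add0r big1.
rewrite natrD !mulrDl !mulrDr IH !mulr_sumr.
under [X in _ + (_ + X)]eq_bigr => i _ do rewrite IH size_lower //.
rewrite !big_split /=.
have -> : \sum_(i < size b) (c == j)%:R * packings (lower b i c) rho =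
  \sum_(i < size b) (c == j)%:R * packings (lower b i j) rho.
  by apply: eq_bigr => i _; case: eqP => [->|]; rewrite ?mul0r.
have -> : \sum_(i < size b) \sum_(k < size b) marked j (lower (lower b i c) k j) rho =
    \sum_(i < size b) \sum_(k < size (lower b i j)) marked j (lower (lower b i j) k c) rho.
  rewrite exchange_big /=; apply: eq_bigr => i _; rewrite size_lower //.
  by apply: eq_bigr => k _; rewrite lowerC.
by ring.
Qed.

(* Newton's identity [j h_j = \sum_i p_i h_(j-i)]: weigh each part of the block
   of size [j] by its length. *)
Lemma packings_newton (B : nat) (j : int) b rho : j <= B%:Z ->
  j%:~R * packings (j :: b) rho =
  \sum_(i < B.+1) i%:R * marked i ((j - i%:Z) :: b) rho.
Proof.
elim: rho j b => [|c rho IH] j b jB.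
  rewrite /= big1 ?mulr0 //; last by move=> i _; rewrite mulr0.
  by case: eqP => [->|]; rewrite ?mul0r ?mulr0.
rewrite [LHS]/= (big_lower_cons (fun b => packings b rho)) !mulrDr IH //.
(* When [c] enters the first block, the weight [j] splits into [c] for this part and [j - c] for the
   rest of the block. *)
have -> : j%:~R * packings (j - c%:Z :: b) rho =
   c%:R * packings (j - c%:Z :: b) rho +
   (j - c%:Z)%:~R * packings (j - c%:Z :: b) rho.
  by rewrite rmorphB /=; ring.
rewrite IH; last by lia.
rewrite mulr_sumr; under [X in _ + (_ + X)]eq_bigr => i _ do rewrite IH //.
(* Only [i = c] contributes to the sum. If [c] exceeds [B], then [j - c] is negative and both sides
   vanish. *)
have -> : c%:R * packings (j - c%:Z :: b) rho =
   \sum_(i < B.+1) i%:R * ((c == i)%:R * packings (j - i%:Z :: b) rho).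
  have [cB|cB] := ltnP c B.+1.
    rewrite (bigD1 (Ordinal cB)) //= eqxx mul1r big1 ?addr0 // => i ic.
    have /negPf-> : c != i by rewrite eq_sym; exact: contra_neq (@val_inj _ _ _ i (Ordinal cB)) ic.
    by rewrite mul0r mulr0.
  rewrite packings_neg ?mulr0 ?big1 // => [i _|/=]; last by apply/orP; left; lia.
  have /negPf-> : c != i by have := ltn_ord i; lia.
  by rewrite mul0r mulr0.
rewrite exchange_big -!big_split /=; apply: eq_bigr => i _.
rewrite (big_lower_cons (fun b => marked i b rho)) !mulrDr mulr_sumr.
rewrite (_ : j - c%:Z - i%:Z = j - i%:Z - c%:Z); last by lia.
by ring.
Qed.

(** * Permutation characters and Jacobi-Trudi *)

Lemma eq_perm_char l (a b : 'I_l -> int) rho :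
  a =1 b -> perm_char a rho = perm_char b rho.
Proof.
move=> ab; rewrite /perm_char; apply: eq_card => f; rewrite !inE.
by apply: eq_forallb => i; rewrite ab.
Qed.

Lemma perm_char_nil l (a : 'I_l -> int) :
  perm_char a [::] = [forall i, a i == 0] :> nat.
Proof.
rewrite /perm_char; set b := [forall i, _ == 0].
have -> : [set f : {ffun 'I_(size (@nil nat)) -> 'I_l} |
    [forall i, ((\sum_(j | f j == i) nth 0%N [::] j)%N)%:Z == a i]] =
    if b then setT else set0.
  apply/setP=> f; rewrite inE (_ : [forall i, _] = b); first by case: (b); rewrite inE.
  by apply: eq_forallb => i; rewrite big1 1?eq_sym // => j; rewrite nth_nil.
by case: b; rewrite ?cards0 // cardsT card_ffun !card_ord expn0.
Qed.

(** Sorting the assignments by the block that receives the first part gives the recursion of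
    [packings], except that every part must be placed. *)
Lemma perm_char_cons l (a : 'I_l -> int) c rho :
  perm_char a (c :: rho) =
  (\sum_i perm_char (fun k => (a k - (if k == i then c%:Z else 0))%R) rho)%N.
Proof.
pose glue (i : 'I_l) (f : {ffun 'I_(size rho) -> 'I_l}) :
    {ffun 'I_(size rho).+1 -> 'I_l} := [ffun k => oapp f i (unlift ord0 k)].
have glue0 i f : glue i f ord0 = i by rewrite ffunE unlift_none.
have glueS i f j : glue i f (lift ord0 j) = f j by rewrite ffunE liftK.
rewrite {1}/perm_char /= -sum1_card (partition_big (fun f : {ffun _} => f ord0) predT) //=.
apply: eq_bigr => i _; rewrite sum1_card /perm_char.
rewrite -[RHS](card_imset _ (f := glue i)); last first.
  by move=> f g fg; apply/ffunP => j; rewrite -(glueS i) fg glueS.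
have sumE f k : (\sum_(j | glue i f j == k) nth 0%N (c :: rho) j)%N =
    ((if k == i then c else 0) + \sum_(j | f j == k) nth 0%N rho j)%N.
  rewrite big_mkcond big_ord_recl glue0 eq_sym /= [in RHS]big_mkcond /=.
  by congr addn; apply: eq_bigr => j _; rewrite glueS.
apply: eq_card => f; apply/andP/imsetP => [[]|[g + ->]].
  rewrite inE => /forallP fP /eqP f0.
  exists [ffun j => f (lift ord0 j)]; last first.
    apply/ffunP => k; rewrite ffunE; case: unliftP => [j|] -> /=; last by [].
    by rewrite ffunE.
  have fE : f = glue i [ffun j => f (lift ord0 j)].
    apply/ffunP => k; rewrite ffunE; case: unliftP => [j|] -> /=; last by [].
    by rewrite ffunE.
  rewrite inE; apply/forallP => k; have := fP k; rewrite fE sumE -fE.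
  by case: (k =P i) => _ /eqP; lia.
rewrite inE => /forallP gP; split; last by rewrite [X in X == _]glue0.
rewrite inE; apply/forallP => k; rewrite sumE.
by have /eqP := gP k; case: (k =P i) => _; lia.
Qed.

Lemma perm_char_perm l (a : 'I_l -> int) (s : 'S_l) rho :
  perm_char (fun i => a (s i)) rho = perm_char a rho.
Proof.
elim: rho a => [|c rho IH] a.
  rewrite !perm_char_nil; congr (nat_of_bool _).
  apply/forallP/forallP => [a0 i|a0 i //].
  by have := a0 ((s^-1)%g i); rewrite permKV.
rewrite !perm_char_cons [RHS](reindex_inj (@perm_inj _ s)).
apply: eq_bigr => i _; rewrite -[RHS]IH; apply: eq_perm_char => k.
by rewrite (inj_eq (@perm_inj _ s)).
Qed.

Definition headed l (x : int) (a : 'I_l -> int) (i : 'I_l.+1) : int :=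
  oapp a x (unlift ord0 i).

Lemma headed0 l x (a : 'I_l -> int) : headed x a ord0 = x.
Proof. by rewrite /headed unlift_none. Qed.

Lemma headedS l x (a : 'I_l -> int) i : headed x a (lift ord0 i) = a i.
Proof. by rewrite /headed liftK. Qed.

Lemma sum_headed l x (a : 'I_l -> int) :
  \sum_i headed x a i = x + \sum_i a i.
Proof.
by rewrite big_ord_recl headed0; congr (_ + _); apply: eq_bigr => i _; rewrite headedS.
Qed.

Lemma nth_image_ord l (a : 'I_l -> int) (i : 'I_l) :
  nth 0 [seq a j | j : 'I_l] i = a i.
Proof. by rewrite (nth_map i) ?size_enum_ord // nth_ord_enum. Qed.

Lemma size_image_ord l (a : 'I_l -> int) : size [seq a j | j : 'I_l] = l.
Proof. by rewrite size_map size_enum_ord. Qed.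

(* The parts left unpacked form an extra block of forced size. *)
Lemma perm_char_packings l (a : 'I_l.+1 -> int) rho :
  \sum_i a i = (sumn rho)%:Z ->
  (perm_char a rho)%:R = packings [seq a (lift ord0 i) | i : 'I_l] rho.
Proof.
elim: rho a => [|c rho IH] a suma.
  rewrite perm_char_nil /=; congr (nat_of_bool _)%:R.
  apply/forallP/allP => [a0 x /mapP[i _ ->] /=|a0 i]; first exact: a0.
  have aS j : a (lift ord0 j) = 0 by apply/eqP/a0/map_f/mem_enum.
  case: (unliftP ord0 i) => [j ->|->]; first by rewrite aS.
  by move: suma; rewrite big_ord_recl big1 ?addr0 => [->|].
have suma' i : \sum_k (a k - (if k == i then c%:Z else 0)) = (sumn rho)%:Z.
  by rewrite sumrB -big_mkcond big_pred1_eq suma /=; lia.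
rewrite perm_char_cons natr_sum big_ord_recl /= !IH //; congr (_ + _).
  by congr packings; apply: eq_map => i; rewrite subr0.
rewrite size_image_ord; apply: eq_bigr => i _; rewrite IH //; congr packings.
apply: (@eq_from_nth _ 0) => [|k]; first by rewrite size_lower !size_image_ord.
rewrite size_image_ord => kl; rewrite nth_lower.
rewrite -[k]/(nat_of_ord (Ordinal kl)) !nth_image_ord.
by rewrite (inj_eq lift_inj) -(inj_eq val_inj).
Qed.

Lemma packings_perm_char l (a : 'I_l -> int) rho :
  packings [seq a i | i : 'I_l] rho =
  (perm_char (headed ((sumn rho)%:Z - \sum_i a i) a) rho)%:R.
Proof.
rewrite perm_char_packings; last by rewrite sum_headed subrK.
by congr packings; apply: eq_map => i; rewrite headedS.
Qed.

(** The recursion hides the symmetry in the blocks. It is visible for [perm_char], where the extra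
    block of unpacked parts is kept fixed by [lift_perm ord0 ord0]. *)
Lemma packings_perm b b' rho :
  perm_eq b b' -> packings b rho = packings b' rho.
Proof.
move=> bb'; have b't : b' = in_tuple b' by [].
move: bb'; rewrite b't => /tuple_permP[p ->].
move: (in_tuple b') p => t p.
have -> : [tuple tnth t (p i) | i < size b'] = [seq tnth t (p i) | i : 'I_(size b')] :> seq _.
  by rewrite /= -val_ord_tuple.
have -> : tval t = [seq tnth t i | i : 'I_(size b')].
  by rewrite -[LHS](map_tnth_enum t).
rewrite !packings_perm_char; congr _%:R.
rewrite -[RHS](perm_char_perm _ (lift_perm ord0 ord0 p)).
have -> : \sum_i tnth t (p i) = \sum_i tnth t i.
  by rewrite [RHS](reindex_inj (@perm_inj _ p)).
apply: eq_perm_char => i; case: (unliftP ord0 i) => [j ->|->].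
  by rewrite lift_perm_lift !headedS.
by rewrite lift_perm_id !headed0.
Qed.

Definition jt_index (mu : seq nat) (s : 'S_(size mu)) (i : 'I_(size mu)) : int :=
  (nth 0%N mu i)%:Z - (i : nat)%:Z + (s i : nat)%:Z.

Lemma sum_jt_index lam (s : 'S_(size lam)) : \sum_i jt_index s i = (sumn lam)%:Z.
Proof.
rewrite big_split sumrB /=.
have -> : \sum_i (s i : nat)%:Z = \sum_(i < size lam) (i : nat)%:Z.
  by rewrite [RHS](reindex_inj (@perm_inj _ s)).
rewrite addrNK sumnE (big_morph Posz PoszD erefl) (big_nth 0%N) big_mkord.
by [].
Qed.

Lemma irr_charE mu rho : (irr_char mu rho)%:~R =
  \sum_(s : 'S_(size mu)) (-1) ^+ s * (perm_char (jt_index s) rho)%:R :> rat.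
Proof.
rewrite /irr_char rmorph_sum; apply: eq_bigr => s _.
by rewrite rmorphM rmorphXn rmorphN1 /= -pmulrn.
Qed.

(** The blocks given by rows 1, 2, ... of the Jacobi-Trudi determinant of (n - |nu|, nu). Row 0 is
    the block of forced size, so the remaining list does not involve n. *)
Definition jt_tail (nu : seq nat) (s : 'S_(size nu).+1) : seq int :=
  [seq (nth 0%N nu i)%:Z - (i.+1)%:Z + (s (lift ord0 i) : nat)%:Z
     | i : 'I_(size nu)].

Lemma irr_char_packings (n0 : nat) (nu : seq nat) rho :
  (n0 + sumn nu)%N = sumn rho ->
  (irr_char (n0 :: nu) rho)%:~R =
  \sum_(s : 'S_(size nu).+1) (-1) ^+ s * packings (jt_tail s) rho.
Proof.
move=> sumE; rewrite irr_charE; apply: eq_bigr => s _.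
rewrite perm_char_packings; first by [].
by rewrite (@sum_jt_index (n0 :: nu) s) /= sumE.
Qed.

(** * Spans of polynomial characters *)

(* A minimiser of the right-hand side has no inversion, since exchanging the two
   values of an inversion decreases the sum. *)
Lemma sum_sqr_perm_lt n (a : 'I_n -> int) (s : 'S_n) :
  (forall i j : 'I_n, (i < j)%N -> a j < a i) -> s != 1%g ->
  \sum_(i < n) (a i + (i : nat)%:Z) ^+ 2 < \sum_(i < n) (a i + (s i : nat)%:Z) ^+ 2.
Proof.
move=> a_dec; pose G (t : 'S_n) := \sum_(i < n) (a i + (t i : nat)%:Z) ^+ 2.
(* The exchange changes the sum by 2 (a_i - a_j) (t_j - t_i), which is negative. *)
have swapG (t : 'S_n) (i j : 'I_n) : (i < j)%N -> (t j < t i)%N ->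
    G (tperm i j * t)%g < G t.
  move=> ij tij; have ji : j != i by rewrite -val_eqE /=; lia.
  rewrite /G (bigD1 i) // (bigD1 j) //= [ltRHS](bigD1 i) // [X in _ < _ + X](bigD1 j) //=.
  rewrite !permM tpermL tpermR (eq_bigr (fun k => (a k + (t k : nat)%:Z) ^+ 2)).
    by rewrite !addrA ltrD2r; have := a_dec _ _ ij; nia.
  by move=> k /andP[ki kj]; rewrite permM tpermD // eq_sym.
have minG (t : 'S_n) : (forall u, G t <= G u) -> t = 1%g.
  move=> tmin; apply/permP => i; rewrite perm1; apply/eqP.
  (* At the least index [i] moved by [t], both [t i] and the preimage [j] of [i] exceed [i], so [i]
     and [j] form an inversion. *)
  have [k] := ubnP i; elim: k i => // k IH i; rewrite ltnS => ik.
  apply: contraTT isT => ti.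
  have fix_lt (j : 'I_n) : (j < i)%N -> t j = j by move=> ji; apply/eqP/IH; lia.
  have iti : (i < t i)%N.
    rewrite ltn_neqAle val_eqE eq_sym ti leqNgt /=; apply/negP => tii.
    by move/eqP: ti; apply; apply: (@perm_inj _ t); rewrite fix_lt.
  pose j := (t^-1)%g i; have tj : t j = i by rewrite permKV.
  have ij : (i < j)%N.
    rewrite ltn_neqAle leqNgt; apply/andP; split.
      by apply: contra ti => /eqP/val_inj ij; rewrite {1}ij tj.
    by apply/negP => ji; move: (ji); rewrite -{1}(fix_lt j) // tj ltnn.
  have := swapG t i j ij; rewrite tj => /(_ iti).
  by rewrite ltNge tmin.
move=> s1; rewrite -/(G s).
have -> : \sum_(i < n) (a i + (i : nat)%:Z) ^+ 2 = G 1%g.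
  by apply: eq_bigr => i _; rewrite perm1.
have [t _ tmin] := @arg_minP _ _ _ 1%g predT G isT.
have t1 : t = 1%g by apply: minG => u; apply: tmin.
rewrite -t1 ltNge; apply: contraNN s1 => Gst; apply/eqP/minG => u.
by apply: le_trans Gst _; apply: tmin.
Qed.

(** The list [L] of coefficients is chosen before [rho]. Since [rho] ranges over cycle types of all
    sizes, this is what makes the coefficients independent of n. *)
Definition in_span (D dom : pred (seq nat)) (e : seq nat -> seq nat -> rat)
    (F : seq nat -> rat) : Prop :=
  exists2 L : seq (rat * seq nat), all (fun t => D t.2) L &
    forall rho, dom rho -> F rho = \sum_(t <- L) t.1 * e t.2 rho.

Section Span.
Variables (D dom : pred (seq nat)) (e : seq nat -> seq nat -> rat).
Local Notation span := (in_span D dom e).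

Lemma span_ext F G : (forall rho, dom rho -> F rho = G rho) -> span G -> span F.
Proof. by move=> FG [L DL eL]; exists L => // rho hr; rewrite FG // eL. Qed.

Lemma span0 : span (fun=> 0).
Proof. by exists [::] => // rho _; rewrite big_nil. Qed.

Lemma span_base b : D b -> span (e b).
Proof.
move=> Db; exists [:: (1, b)]; rewrite /= ?Db // => rho _.
by rewrite big_seq1 mul1r.
Qed.

Lemma spanD F G : span F -> span G -> span (fun rho => F rho + G rho).
Proof.
move=> [L DL eL] [M DM eM]; exists (L ++ M); first by rewrite all_cat DL.
by move=> rho hr; rewrite big_cat eL // eM.
Qed.

Lemma spanZ x F : span F -> span (fun rho => x * F rho).
Proof.
move=> [L DL eL]; exists [seq (x * t.1, t.2) | t <- L]; first by rewrite all_map.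
move=> rho hr; rewrite big_map eL // mulr_sumr.
by apply: eq_bigr => t _; rewrite mulrA.
Qed.

Lemma span_sum (I : eqType) (r : seq I) (P : pred I) (F : I -> seq nat -> rat) :
  (forall i, i \in r -> P i -> span (F i)) ->
  span (fun rho => \sum_(i <- r | P i) F i rho).
Proof.
elim: r => [|i r IH] spanF.
  by apply: span_ext span0 => rho _; rewrite big_nil.
have {}IH : span (fun rho => \sum_(i <- r | P i) F i rho).
  by apply: IH => j jr; apply: spanF; rewrite inE jr orbT.
have [Pi|Pi] := boolP (P i); last first.
  by apply: span_ext IH => rho _; rewrite big_cons (negPf Pi).
apply: (@span_ext _ (fun rho => F i rho + \sum_(i <- r | P i) F i rho)).
  by move=> rho _; rewrite big_cons Pi.
by apply: spanD IH; apply: spanF; rewrite ?inE ?eqxx.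
Qed.

Lemma span_map (D' dom' : pred (seq nat)) e' F (m : seq nat -> rat) :
  {subset dom <= dom'} ->
  (forall b, D' b -> span (fun rho => m rho * e' b rho)) ->
  in_span D' dom' e' F -> span (fun rho => m rho * F rho).
Proof.
move=> sdom De' [L DL eL].
apply: (@span_ext _ (fun rho => \sum_(t <- L) t.1 * (m rho * e' t.2 rho))).
  move=> rho hr; rewrite eL ?mulr_sumr; last exact: sdom.
  by apply: eq_bigr => t _; rewrite mulrCA.
by apply: span_sum => t tL _; apply/spanZ/De'/(allP DL).
Qed.

End Span.

Definition pack (b rho : seq nat) : rat := packings (map Posz b) rho.

Definition pack_span (d : nat) :=
  in_span (fun b => sumn b <= d)%N (all (leq 1)) pack.

Lemma sum_Posz b : \sum_(x <- map Posz b) x = (sumn b)%:Z.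
Proof. by rewrite sumnE (big_morph Posz PoszD erefl) big_map. Qed.

Lemma nonneg_Posz (b : seq int) :
  ~~ has (fun x => x < 0) b -> map Posz (map absz b) = b.
Proof.
rewrite -all_predC => /allP b0; rewrite -map_comp -[RHS]map_id.
by apply/eq_in_map => x /b0 /=; lia.
Qed.

Lemma packings_pack_span (b : seq int) d :
  \sum_(x <- b) x <= d%:Z -> pack_span d (packings b).
Proof.
move=> bd; have [neg|/nonneg_Posz b0] := boolP (has (fun x => x < 0) b).
  by apply: span_ext (span0 _ _ _) => rho _; rewrite packings_neg.
rewrite -b0; apply: span_base; rewrite -[b]b0 sum_Posz in bd; lia.
Qed.

(** Newton's identity for a first block of size [j] ends with [j * marked j (0 :: b)], which is j
    times the wanted function. The other terms have [i < j], and setting aside [i] next to a block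
    of size [j - i] keeps the total degree, so induction on [j] applies; the term [i = 0] has
    coefficient 0. *)
Lemma marked_pack_span j (b : seq int) d : (0 < j)%N ->
  j%:Z + \sum_(x <- b) x <= d%:Z -> pack_span d (marked j b).
Proof.
have [k] := ubnP j; elim: k j b => // k IH j b; rewrite ltnS => jk j0 bd.
pose c (i : nat) : rat := - (i%:R / j%:R).
apply: (@span_ext _ _ _ _ (fun rho => packings (j%:Z :: b) rho +
    \sum_(i < j) c i * marked i ((j%:Z - i%:Z) :: b) rho)); last first.
  apply: spanD; first by apply: packings_pack_span; rewrite big_cons.
  apply: span_sum => i _ _; have [i0|i0] := posnP i.
    by apply: span_ext (span0 _ _ _) => rho _; rewrite /c i0 mulNr !mul0r oppr0.
  have ij := ltn_ord i.
  apply: spanZ; apply: IH => //.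
    by apply: leq_trans ij _.
  by rewrite big_cons addrA [X in X + _]addrC subrK.
move=> rho rho0; have := @packings_newton j j%:Z b rho (lexx _).
have j0' : j%:R != 0 :> rat by rewrite pnatr_eq0 -lt0n.
rewrite big_ord_recr /= subrr marked_cons0 // => E.
have -> : \sum_(i < j) c i * marked i (j%:Z - i%:Z :: b) rho =
   - (\sum_(i < j) i%:R * marked i (j%:Z - i%:Z :: b) rho) / j%:R.
  rewrite mulNr mulr_suml -sumrN; apply: eq_bigr => i _; rewrite /c; ring.
have -> : packings (j%:Z :: b) rho = (j%:R * packings (j%:Z :: b) rho) / j%:R.
  by rewrite mulrC mulKf.
rewrite -pmulrn in E; rewrite E.
by field.
Qed.

Lemma count_pack_span j F d : (0 < j)%N ->
  pack_span d F -> pack_span (d + j) (fun rho => (count_mem j rho)%:R * F rho).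
Proof.
move=> j0; apply: span_map => // b bd.
apply: (@span_ext _ _ _ _ (fun rho => marked j (map Posz b) rho +
   \sum_(i < size (map Posz b)) marked j (lower (map Posz b) i j) rho)).
  by move=> rho _; rewrite -count_packings.
apply: spanD; first by apply: marked_pack_span => //; rewrite sum_Posz; lia.
apply: span_sum => i _ _; apply: marked_pack_span => //.
have -> : \sum_(x <- lower (map Posz b) i j) x = (sumn b)%:Z - j%:Z.
  rewrite -sum_Posz [LHS](big_nth 0) [in RHS](big_nth 0) !big_mkord size_lower //.
  under eq_bigr => k _ do rewrite nth_lower.
  rewrite sumrB; congr (_ - _); rewrite -big_mkcond (bigD1 i) //= big1 ?addr0 // => k.
  by case/andP => /eqP/val_inj ->; rewrite eqxx.
by lia.
Qed.

Lemma monomial_pack_span K (e : K.-tuple nat) :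
  pack_span (mweight e)
    (fun rho => \prod_(i < K) (count_mem i.+1 rho)%:R ^+ tnth e i).
Proof.
rewrite /mweight; elim: (index_enum _) => [|i r IH].
  apply: span_ext (span_base (b := [::]) _ _ _) => [rho _|]; last by rewrite big_nil.
  by rewrite big_nil /pack packings_nil.
rewrite big_cons; set w := \sum_(_ <- _) _ in IH *.
apply: (@span_ext _ _ _ _ (fun rho => (count_mem i.+1 rho)%:R ^+ tnth e i *
   \prod_(i <- r) (count_mem i.+1 rho)%:R ^+ tnth e i)).
  by move=> rho _; rewrite big_cons.
elim: (tnth e i) => [|k IHk].
  by rewrite muln0; apply: span_ext IH => rho _; rewrite mul1r.
rewrite mulnS -addnA addnC.
apply: span_ext (count_pack_span _ IHk) => // rho _.
by rewrite exprS mulrA.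
Qed.

Definition ratpoly_eval K (P : ratpoly K) (rho : seq nat) : rat :=
  \sum_(t <- P) t.1 * \prod_(i < K) (count_mem i.+1 rho)%:R ^+ tnth t.2 i.

(** Equal monomials are collected because [qdeg] ignores those whose coefficients cancel, although
    they may occur in the list [P]. *)
Lemma ratpoly_evalE K (P : ratpoly K) rho :
  ratpoly_eval P rho = \sum_(e <- undup (map snd P))
     qcoef P e * \prod_(i < K) (count_mem i.+1 rho)%:R ^+ tnth e i.
Proof.
rewrite /qcoef; under [RHS]eq_bigr => e _ do rewrite mulr_suml.
rewrite (exchange_big_dep predT) //= /ratpoly_eval [LHS]big_seq [RHS]big_seq.
apply: eq_bigr => t tP; have tu : t.2 \in undup (map snd P) by rewrite mem_undup map_f.
rewrite [RHS]big_mkcond (bigD1_seq t.2) ?undup_uniq //= eqxx [X in _ + X]big1 ?addr0 // => e.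
by rewrite eq_sym => /negPf ->.
Qed.

Lemma ratpoly_pack_span K (P : ratpoly K) : pack_span (qdeg P) (ratpoly_eval P).
Proof.
apply: span_ext (span_sum (P := predT) _) => [rho _|]; first exact: ratpoly_evalE.
move=> e; rewrite mem_undup => /mapP[t tP ->] _ /=.
have [c0|c0] := eqVneq (qcoef P t.2) 0.
  by apply: span_ext (span0 _ _ _) => rho _; rewrite c0 mul0r.
have [L DL eL] := monomial_pack_span t.2; apply: spanZ; exists L => //.
apply: sub_all DL => s /leq_trans; apply.
exact: leq_bigmax_seq.
Qed.

(** * Straightening *)

(** The condition [d <= sumn rho] keeps the natural subtraction from truncating. The list built here
    need not be decreasing; [irr_char] then means the Jacobi-Trudi determinant. *)
Definition irr_span (d : nat) :=
  in_span (fun nu => is_partition nu && (sumn nu <= d)%N)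
    (fun rho => all (leq 1) rho && (d <= sumn rho)%N)
    (fun nu rho => (irr_char ((sumn rho - sumn nu)%N :: nu) rho)%:~R).

Lemma pack_perm b b' rho : perm_eq b b' -> pack b rho = pack b' rho.
Proof. by move=> bb'; apply/packings_perm/perm_map. Qed.

Lemma perm_pos_parts b :
  perm_eq b (nseq (count_mem 0%N b) 0%N ++ sort geq (filter (leq 1) b)).
Proof.
rewrite -(perm_filterC (pred1 0%N) b).
have -> : filter (pred1 0%N) b = nseq (count_mem 0%N b) 0%N.
  rewrite -size_filter; apply/all_pred1P/allP => x; rewrite mem_filter => /andP[].
  by [].
rewrite perm_cat2l perm_sym perm_sort.
by rewrite (@eq_filter _ (predC (pred1 0%N)) (leq 1)) // => x /=; rewrite lt0n.
Qed.

Lemma pack_pos_parts b rho : all (leq 1) rho ->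
  pack b rho = pack (sort geq (filter (leq 1) b)) rho.
Proof.
move=> rho0; rewrite (pack_perm _ (perm_pos_parts b)).
elim: (count_mem _ _) => //= k IH.
by rewrite /pack map_cons packings_cons0.
Qed.

Lemma pos_parts_partition b : is_partition (sort geq (filter (leq 1) b)).
Proof.
rewrite /is_partition sort_sorted /=; last by move=> x y; apply: leq_total.
by rewrite all_sort filter_all.
Qed.

(** The sum of squares of the composition (d - |b|, b). A fixed [d] stands in for n, so the
    induction governed by this measure is the same for all n. *)
Definition spread (d : nat) (b : seq nat) : nat :=
  ((d - sumn b) ^ 2 + \sum_(x <- b) x ^ 2)%N.

Lemma spread_le d b : (sumn b <= d)%N -> (spread d b <= d ^ 2)%N.
Proof.
have sqr_le : (\sum_(x <- b) x ^ 2 <= sumn b ^ 2)%N.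
  elim: b => [|x b IH]; first by rewrite big_nil.
  by rewrite big_cons /=; nia.
by rewrite /spread => bd; nia.
Qed.

Lemma spread_pos_parts d b : spread d (sort geq (filter (leq 1) b)) = spread d b.
Proof.
have pb := perm_pos_parts b; rewrite /spread (perm_sumn pb) (perm_big _ pb) /=.
rewrite sumn_cat big_cat /= sumn_nseq mul0n add0n; congr (_ + _)%N.
by rewrite big_nseq; elim: (count_mem _ _) => // k IH; rewrite iterS -IH.
Qed.

Lemma sumn_pos_parts b : sumn (sort geq (filter (leq 1) b)) = sumn b.
Proof.
by rewrite [RHS](perm_sumn (perm_pos_parts b)) sumn_cat sumn_nseq mul0n.
Qed.

Lemma jt_tail1 nu : jt_tail (1%g : 'S_(size nu).+1) = map Posz nu.
Proof.
apply: (@eq_from_nth _ 0); rewrite size_image_ord ?size_map // => i inu.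
rewrite -[i]/(nat_of_ord (Ordinal inu)) nth_image_ord (nth_map 0%N) //.
by rewrite perm1 lift0 subrK.
Qed.

Lemma sum_jt_tail nu (s : 'S_(size nu).+1) :
  \sum_(x <- jt_tail s) x = (sumn nu)%:Z - (s ord0 : nat)%:Z.
Proof.
have := @sum_jt_index (0%N :: nu) s; rewrite big_ord_recl /jt_index /=.
rewrite /jt_tail big_map big_enum /= => <-; rewrite subrr add0r addrC addKr.
by apply: eq_bigr => i _.
Qed.

Lemma sorted_shift_decr lam (i j : nat) :
  sorted geq lam -> (i < j < size lam)%N ->
  (nth 0%N lam j)%:Z - j%:Z < (nth 0%N lam i)%:Z - i%:Z.
Proof.
move=> srt /andP[ij jl].
have geq_trans : transitive geq by move=> x y z /= yx xz; apply: leq_trans xz yx.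
have := sorted_leq_nth geq_trans leqnn 0%N srt i j.
rewrite !inE (ltn_trans ij jl) jl (ltnW ij) => /(_ isT isT isT) /=; lia.
Qed.

(** Apply [sum_sqr_perm_lt] to the entries of (N - |nu|, nu) minus their indices. These decrease
    strictly because nu_1 <= N - |nu|, and row 0 becomes N - |nu| + s(0) = N - |g|. *)
Lemma spread_jt_tail N nu (s : 'S_(size nu).+1) (g : seq nat) :
  sorted geq nu -> (head 0 nu + sumn nu <= N)%N -> s != 1%g ->
  jt_tail s = map Posz g -> (spread N nu < spread N g)%N.
Proof.
move=> nuP nuN s1 gE.
have sg : (sumn g + s ord0)%N = sumn nu.
  by have := sum_jt_tail s; rewrite gE sum_Posz; lia.
pose a (i : 'I_(size nu).+1) :=
  (nth 0%N ((N - sumn nu)%N :: nu) i)%:Z - (i : nat)%:Z.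
have a_dec (i j : 'I_(size nu).+1) : (i < j)%N -> a j < a i.
  move=> ij; apply: sorted_shift_decr; last by rewrite ij /=.
  by case: (nu) nuP nuN => //= x l ->; rewrite andbT; lia.
have := sum_sqr_perm_lt a_dec s1.
rewrite !big_ord_recl /= /a /=.
have -> : \sum_(i < size nu) ((nth 0%N nu i)%:Z - (lift ord0 i : nat)%:Z +
    (lift ord0 i : nat)%:Z) ^+ 2 = (\sum_(x <- nu) x ^ 2)%N.
  rewrite (big_morph Posz PoszD erefl) [RHS](big_nth 0%N) big_mkord.
  by apply: eq_bigr => i _; rewrite subrK; lia.
have -> : \sum_(i < size nu) ((nth 0%N nu i)%:Z - (lift ord0 i : nat)%:Z +
    (s (lift ord0 i) : nat)%:Z) ^+ 2 = (\sum_(x <- g) x ^ 2)%N.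
  rewrite (big_morph Posz PoszD erefl).
  transitivity (\sum_(x <- jt_tail s) x ^+ 2); last by rewrite gE big_map.
  by rewrite /jt_tail big_map big_enum.
rewrite /spread; nia.
Qed.

(* Straightening: Jacobi-Trudi expresses [irr_char] as [pack nu] plus terms of
   larger [spread], hence can be inverted. *)
Lemma pack_irr_span d b : (sumn b <= d)%N -> irr_span d (pack b).
Proof.
(* With N = 2d, every partition nu of size at most d satisfies nu_1 + |nu| <= N, as [spread_jt_tail]
   requires, and [spread] is bounded by N^2. *)
have [k] := ubnP ((2 * d) ^ 2 - spread (2 * d) b)%N.
elim: k b => // k IH b; rewrite ltnS => bk bd.
pose nu := sort geq (filter (leq 1) b).
have nu_part : is_partition nu := pos_parts_partition b.
have nu_srt : sorted geq nu by case/andP: nu_part.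
have nud : (sumn nu <= d)%N by rewrite sumn_pos_parts.
have hd_nu : (head 0 nu <= sumn nu)%N by case: (nu) => //= x l; apply: leq_addr.
have {}bk : ((2 * d) ^ 2 - spread (2 * d) nu <= k)%N by rewrite spread_pos_parts.
apply: (@span_ext _ _ _ _ (fun rho =>
    (irr_char ((sumn rho - sumn nu)%N :: nu) rho)%:~R +
    \sum_(s : 'S_(size nu).+1 | s != 1%g)
       - (-1) ^+ s * packings (jt_tail s) rho)).
  move=> rho /andP[rho0 drho]; rewrite irr_char_packings ?subnK //; last by lia.
  rewrite (bigD1 1%g) //= odd_perm1 mul1r jt_tail1 pack_pos_parts //.
  under [X in _ + X]eq_bigr => s _ do rewrite mulNr.
  by rewrite sumrN addrK.
apply: spanD; first by apply: span_base; rewrite nu_part.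
apply: span_sum => s _ s1; apply: spanZ.
have [neg|/nonneg_Posz gE] := boolP (has (fun x => x < 0) (jt_tail s)).
  by apply: span_ext (span0 _ _ _) => rho _; rewrite packings_neg.
move: (map absz _) gE => g gE; rewrite -gE.
have sg : (sumn g + s ord0)%N = sumn nu.
  by have := sum_jt_tail s; rewrite -gE sum_Posz; lia.
apply: IH; last by lia.
have lt := @spread_jt_tail (2 * d) nu s g nu_srt _ s1 (esym gE).
have := @spread_le (2 * d) g; lia.
Qed.

Lemma ratpoly_irr_span K (P : ratpoly K) : irr_span (qdeg P) (ratpoly_eval P).
Proof.
have [L DL eL] := ratpoly_pack_span P.
apply: (@span_ext _ _ _ _ (fun rho => \sum_(t <- L) t.1 * pack t.2 rho)).
  by move=> rho /andP[rho0 _]; apply: eL.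
by apply: span_sum => t tL _; apply/spanZ/pack_irr_span/(allP DL).
Qed.

(** * Cycles and colorings *)

Section Cycles.
Variables (T : finType) (w : {perm T}) (A : {set T}).
Hypothesis A_stable : forall x, (w x \in A) = (x \in A).

Let cycles := enum [set C in porbits w | C \subset A].
Local Notation r := (size (ctype_on w A)).

Definition cycle_index (x : T) : option 'I_r :=
  insub (index (porbit w x) cycles).

Let size_cycles : size cycles = r.
Proof. by rewrite /ctype_on size_map. Qed.

Lemma perm_iter_stable k x : ((w ^+ k)%g x \in A) = (x \in A).
Proof.
by elim: k => [|k IH]; rewrite ?expg0 ?perm1 // expgSr permM A_stable.
Qed.

Lemma mem_cycles x : (porbit w x \in cycles) = (x \in A).
Proof.
rewrite mem_enum inE imset_f //=; apply/subsetP/idP => [sub|xA y].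
  exact/sub/porbit_id.
by case/porbitP => k ->; rewrite perm_iter_stable.
Qed.

Lemma nth_cycles (j : 'I_r) : exists x, nth set0 cycles j = porbit w x.
Proof.
have jr : (j < size cycles)%N by rewrite size_cycles.
have := mem_nth set0 jr; rewrite mem_enum inE => /andP[/imsetP[x _ ->] _].
by exists x.
Qed.

Lemma cycle_index_eq x (j : 'I_r) :
  (cycle_index x == Some j) = (x \in nth set0 cycles j).
Proof.
rewrite /cycle_index; have jr : (j < size cycles)%N by rewrite size_cycles.
apply/eqP/idP => [|xj].
  case: insubP => // i ir iE [<-]; rewrite [in nth _ _ _]iE nth_index ?porbit_id //.
  by rewrite -index_mem size_cycles.
have [y Cy] := nth_cycles j.
have -> : porbit w x = nth set0 cycles j.
  by apply/eqP; rewrite Cy eq_porbit_mem -Cy.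
by rewrite index_uniq ?enum_uniq // valK.
Qed.

Lemma cycle_index_perm x : cycle_index (w x) = cycle_index x.
Proof.
rewrite /cycle_index; congr (insub (index _ _)).
by have := porbit_perm w 1 x; rewrite expg1.
Qed.

Lemma cycle_index_isSome x : (cycle_index x : bool) = (x \in A).
Proof.
rewrite /cycle_index -mem_cycles -index_mem size_cycles.
by case: insubP => [j -> //|/negPf ->].
Qed.

Lemma sum_ctype (p : pred 'I_r) :
  (\sum_(j | p j) nth 0%N (ctype_on w A) j)%N =
  #|[set x | oapp p false (cycle_index x)]|.
Proof.
have sz (j : 'I_r) :
    nth 0%N (ctype_on w A) j = (\sum_x (cycle_index x == Some j))%N.
  rewrite (nth_map set0) ?size_cycles // -sum1_card big_mkcond.
  by apply: eq_bigr => x _; rewrite -cycle_index_eq; case: eqP.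
under eq_bigr => j _ do rewrite sz.
rewrite exchange_big /= -sum1_card [RHS]big_mkcond; apply: eq_bigr => x _.
rewrite inE; case: (cycle_index x) => [i|] /=; last by rewrite big1.
rewrite big_mkcond (bigD1 i) //= eqxx big1 ?addn0; first by case: (p i).
by move=> j ji; rewrite (inj_eq Some_inj) eq_sym (negPf ji) if_same.
Qed.

Lemma sumn_ctype_on : sumn (ctype_on w A) = #|A|.
Proof.
rewrite sumnE (big_nth 0%N) big_mkord (sum_ctype predT); apply: eq_card => x.
by rewrite inE -cycle_index_isSome; case: cycle_index.
Qed.

Definition color (X Y : Type) (e : X -> Y) (y0 : Y) (f : 'I_r -> X) (x : T) : Y :=
  if cycle_index x is Some j then e (f j) else y0.

(** Distributing the cycles inside [A] into blocks amounts to coloring [A] by block labels,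
    constantly on cycles. The embedding [e] and the color [y0] outside [A] allow both a coloring of
    the whole set and one whose outside points carry a separate color. *)
Lemma perm_char_color l (a : 'I_l -> int) (Y : finType) (e : 'I_l -> Y) (y0 : Y) :
  injective e ->
  perm_char a (ctype_on w A) =
  #|[set f : {ffun T -> Y} | [&& [forall x, f (w x) == f x],
       [forall x, if x \in A then f x \in codom e else f x == y0] &
       [forall i, #|[set x in A | f x == e i]|%:Z == a i]]]|.
Proof.
move=> e_inj; pose F (f : {ffun 'I_r -> 'I_l}) := [ffun x => color e y0 f x].
have fibre f i : #|[set x in A | F f x == e i]| =
    (\sum_(j | f j == i) nth 0%N (ctype_on w A) j)%N.
  rewrite sum_ctype; apply: eq_card => x; rewrite !inE ffunE /color.
  rewrite -cycle_index_isSome; case: cycle_index => //= j.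
  by rewrite (inj_eq e_inj).
have rep (j : 'I_r) : exists x, cycle_index x == Some j.
  by have [y Cy] := nth_cycles j; exists y; rewrite cycle_index_eq Cy porbit_id.
have F_inj : injective F.
  move=> f g /ffunP fg; apply/ffunP => j; have [x /eqP xi] := rep j.
  by have := fg x; rewrite !ffunE /color xi => /e_inj.
rewrite /perm_char -(card_imset _ F_inj); apply: eq_card => f; rewrite inE.
apply/imsetP/and3P => [[g + ->]|[/forallP f_inv /forallP f_cod /forallP f_fib]].
  rewrite inE => /forallP g_fib; split.
  - by apply/forallP => x; rewrite !ffunE /color cycle_index_perm.
  - apply/forallP => x; rewrite ffunE /color -cycle_index_isSome.
    by case: cycle_index => //= j; apply: codom_f.
  - by apply/forallP => i; rewrite fibre; apply: g_fib.
(* To recover the block of a cycle, read the color at one chosen point of it; invariance makes the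
   choice immaterial. *)
pose pt j := xchoose (rep j).
have ptA j : pt j \in A.
  by rewrite -cycle_index_isSome (eqP (xchooseP (rep j))).
have pt_cod j : f (pt j) \in codom e by have := f_cod (pt j); rewrite ptA.
have f_orbit x y : y \in porbit w x -> f y = f x.
  case/porbitP => k ->; elim: k => [|k IH]; first by rewrite expg0 perm1.
  by rewrite expgSr permM (eqP (f_inv _)).
have fE : f = F [ffun j => iinv (pt_cod j)].
  apply/ffunP => x; rewrite !ffunE /color.
  case E: (cycle_index x) => [j|]; last first.
    have := f_cod x; rewrite -cycle_index_isSome E /= => /eqP //.
  rewrite ffunE f_iinv; apply: f_orbit; move/eqP: E (xchooseP (rep j)).
  rewrite -/(pt j) !cycle_index_eq.
  have [y ->] := nth_cycles j.
  by rewrite -!eq_porbit_mem => /eqP -> /eqP ->.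
exists [ffun j => iinv (pt_cod j)] => //; rewrite inE; apply/forallP => i.
by rewrite -fibre -fE.
Qed.

End Cycles.

Lemma ctype_gt0 (T : finType) (w : {perm T}) : all (leq 1) (ctype w).
Proof.
apply/allP => k /mapP[C + ->]; rewrite mem_enum inE => /andP[/imsetP[x _ ->] _].
by rewrite lt0n card_porbit_neq0.
Qed.

Lemma sumn_ctype n (w : 'S_n) : sumn (ctype w) = n.
Proof.
by rewrite sumn_ctype_on ?cardsT ?card_ord // => x; rewrite !inE.
Qed.

Lemma count_ctype (T : finType) (w : {perm T}) j :
  count_mem j (ctype w) = cyc_count w j.
Proof.
rewrite count_map -size_filter /cyc_count cardE; apply/perm_size/uniq_perm.
- by rewrite filter_uniq ?enum_uniq.
- exact: enum_uniq.
by move=> C; rewrite mem_filter !mem_enum !inE subsetT andbT andbC.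
Qed.

Lemma chiP_ctype K (P : ratpoly K) n (w : 'S_n) :
  chiP P w = ratpoly_eval P (ctype w).
Proof.
apply: eq_bigr => t _; congr (_ * _); apply: eq_bigr => i _.
by rewrite count_ctype.
Qed.

Lemma chiP_decomposition K (P : ratpoly K) :
  exists (S : seq (seq nat)) (d : seq nat -> rat),
     [/\ uniq S,
         (forall nu, nu \in S -> is_partition nu /\ (sumn nu <= qdeg P)%N) &
         forall n : nat, (2 * qdeg P <= n)%N ->
           forall w : {perm 'I_n},
             chiP P w = \sum_(nu <- S) d nu * chi ((n - sumn nu)%N :: nu) w].
Proof.
have [L /allP DL eL] := ratpoly_irr_span P.
(* A partition may occur several times in [L], so its coefficients are added up. *)
exists (undup (map snd L)), (fun nu => \sum_(t <- L | t.2 == nu) t.1).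
split; first exact: undup_uniq.
  by move=> nu; rewrite mem_undup => /mapP[t /DL /andP[] ? ? ->].
move=> n n2d w; rewrite chiP_ctype eL; last by rewrite ctype_gt0 sumn_ctype; lia.
under [RHS]eq_bigr => nu _ do rewrite mulr_suml.
rewrite (exchange_big_dep predT) //= big_seq [RHS]big_seq.
apply: eq_bigr => t tL; have tu : t.2 \in undup (map snd L) by rewrite mem_undup map_f.
rewrite [RHS]big_mkcond (bigD1_seq t.2) ?undup_uniq //= eqxx [X in _ + X]big1.
  by rewrite addr0 /chi sumn_ctype.
by move=> e; rewrite eq_sym => /negPf ->.
Qed.

(** * Orbits of colorings *)

Section Recoloring.
Variables (T Y : finType).

Definition recolor (f : {ffun T -> Y}) (s : {perm T}) : {ffun T -> Y} :=
  [ffun x => f ((s^-1)%g x)].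

Lemma recolor1 : recolor^~ 1%g =1 id.
Proof. by move=> f; apply/ffunP => x; rewrite ffunE invg1 perm1. Qed.

Lemma recolorM f : act_morph recolor f.
Proof. by move=> s t; apply/ffunP => x; rewrite !ffunE invMg permM. Qed.

Canonical recolor_action := TotalAction recolor1 recolorM.

Lemma recolor_fix f s : (recolor f s == f) = [forall x, f (s x) == f x].
Proof.
apply/eqP/forallP => [fs x|fs].
  by rewrite -{1}fs ffunE permK.
by apply/ffunP => x; rewrite ffunE -{2}[x](permKV s) (eqP (fs _)).
Qed.

Definition color_count (f : {ffun T -> Y}) (y : Y) : nat := #|[set x | f x == y]|.

Lemma color_count_recolor f s y : color_count (recolor f s) y = color_count f y.
Proof.
rewrite -[RHS](card_imset _ (@perm_inj _ s)); apply: eq_card => x.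
rewrite inE ffunE; apply/idP/imsetP => [fx|[z + ->]].
  by exists ((s^-1)%g x); rewrite ?inE ?permKV.
by rewrite inE permK.
Qed.

Lemma sum_color_count f : (\sum_y color_count f y)%N = #|T|.
Proof.
rewrite -sum1_card (partition_big f predT) //=; apply: eq_bigr => y _.
by rewrite sum1dep_card.
Qed.

End Recoloring.

Lemma count_mktuple n (Y : finType) (f : {ffun 'I_n -> Y}) y :
  count_mem y [tuple f i | i < n] = color_count f y.
Proof.
rewrite /= -val_ord_tuple /= count_map -sum1_count big_enum_cond.
by rewrite sum1dep_card; apply: eq_card => x; rewrite !inE.
Qed.

(** Two colorings with equal color counts have value tuples that are rearrangements of each other,
    and the rearranging permutation carries one coloring to the other. *)
Lemma recolor_orbit n (Y : finType) (f g : {ffun 'I_n -> Y}) :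
  (orbit (recolor_action _ _) setT f == orbit (recolor_action _ _) setT g) =
  [forall y, color_count f y == color_count g y].
Proof.
apply/eqP/forallP => [fg y|fg].
  have : f \in orbit (recolor_action _ _) setT g by rewrite -fg orbit_refl.
  by case/orbitP => s _ <-; rewrite /= color_count_recolor.
apply/orbit_eqP; rewrite orbit_sym.
have : perm_eq [tuple f i | i < n] [tuple g i | i < n].
  by apply/allP => y _; rewrite /= !count_mktuple fg.
case/tuple_permP => p fE; apply/orbitP; exists p; rewrite ?inE //.
apply/ffunP => x; rewrite ffunE.
have {}fE : [tuple f i | i < n] = [tuple tnth [tuple g i | i < n] (p i) | i < n].
  exact: val_inj.
have := congr1 (fun t => tnth t ((p^-1)%g x)) fE.
by rewrite !tnth_mktuple permKV.
Qed.

Lemma exists_coloring n (Y : finType) (M : Y -> nat) : (\sum_y M y)%N = n ->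
  exists f : {ffun 'I_n -> Y}, forall y, color_count f y = M y.
Proof.
(* List each color [y] exactly [M y] times; the list has length [n] and is read as a coloring. *)
move=> sumM; pose s := flatten [seq nseq (M y) y | y <- enum Y].
have s_size : size s == n.
  rewrite size_flatten /shape -map_comp sumnE big_map big_enum -sumM /=.
  by apply/eqP/eq_bigr => y _; rewrite size_nseq.
exists [ffun i => tnth (Tuple s_size) i] => y; rewrite -count_mktuple.
have -> : [tuple [ffun i => tnth (Tuple s_size) i] i | i < n] = Tuple s_size.
  by apply: eq_from_tnth => i; rewrite tnth_mktuple ffunE.
rewrite /= /s count_flatten -map_comp sumnE big_map big_enum /=.
rewrite (bigD1 y) //= count_nseq /= eqxx mul1n big1 ?addn0 // => z zy.
by rewrite count_nseq /= (negPf zy).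
Qed.

Lemma color_count_fst n (Y Z : finType) (h : {ffun 'I_n -> Y * Z}) y :
  #|[set x | (h x).1 == y]| = (\sum_z color_count h (y, z))%N.
Proof.
rewrite -sum1dep_card (partition_big (fun x => (h x).2) predT) //=.
by apply: eq_bigr => z _; rewrite sum1dep_card; apply: eq_card => x; rewrite !inE.
Qed.

Lemma color_count_snd n (Y Z : finType) (h : {ffun 'I_n -> Y * Z}) z :
  #|[set x | (h x).2 == z]| = (\sum_y color_count h (y, z))%N.
Proof.
rewrite -sum1dep_card (partition_big (fun x => (h x).1) predT) //=.
apply: eq_bigr => y _; rewrite sum1dep_card; apply: eq_card => x.
by rewrite !inE andbC.
Qed.

(* Color [ord0] marks the points outside all blocks. *)
Definition block_colorings (T : finType) p (a : 'I_p -> int) : {set {ffun T -> 'I_p.+1}} :=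
  [set f : {ffun T -> 'I_p.+1} |
    [forall i, (color_count f (lift ord0 i))%:Z == a i]].

Definition fixed_colorings (T Y : finType) (w : {perm T}) : {set {ffun T -> Y}} :=
  [set f : {ffun T -> Y} | [forall x, f (w x) == f x]].

(** The color classes partition [n] points, so the prescribed sizes of the blocks force the size of
    the class of [ord0]. *)
Lemma perm_char_headed n (w : 'S_n) p (a : 'I_p -> int) :
  perm_char (headed (n%:Z - \sum_i a i) a) (ctype w) =
  #|fixed_colorings _ w :&: block_colorings _ a|.
Proof.
rewrite (@perm_char_color _ _ setT _ _ _ _ id ord0) //; last by move=> x; rewrite !inE.
apply: eq_card => f; rewrite !inE; congr (_ && _).
have cE i : #|[set x in setT | f x == i]| = color_count f i.
  by apply: eq_card => x; rewrite !inE.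
apply/andP/forallP => [[_ /forallP fP] i|fP].
  by have := fP (lift ord0 i); rewrite cE headedS.
split; apply/forallP => i; first by rewrite inE codomE map_id mem_enum.
rewrite cE; case: (unliftP ord0 i) => [j|] ->; first by rewrite headedS fP.
have := sum_color_count f; rewrite big_ord_recl card_ord headed0.
move/(congr1 Posz); rewrite PoszD (big_morph Posz PoszD erefl).
by rewrite (eq_bigr a) => [<-|j _]; [rewrite addrK | apply/eqP/fP].
Qed.

Definition pair_colorings n p l (a : 'I_p -> int) (b : 'I_l -> int) :=
  [set h : {ffun 'I_n -> 'I_p.+1 * 'I_l.+1} |
    [forall i, #|[set x | (h x).1 == lift ord0 i]|%:Z == a i] &&
    [forall j, #|[set x | (h x).2 == lift ord0 j]|%:Z == b j]].

Lemma fixed_pair_colorings n (w : 'S_n) p l (a : 'I_p -> int) (b : 'I_l -> int) :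
  (#|fixed_colorings _ w :&: block_colorings _ a| *
   #|fixed_colorings _ w :&: block_colorings _ b|)%N =
  #|fixed_colorings _ w :&: pair_colorings n a b|.
Proof.
rewrite -cardsX; pose F (fg : {ffun 'I_n -> 'I_p.+1} * {ffun 'I_n -> 'I_l.+1}) :=
  [ffun x => (fg.1 x, fg.2 x)].
have F_inj : injective F.
  move=> [f g] [f' g'] /ffunP FF; congr pair; apply/ffunP => x;
  by have := FF x; rewrite !ffunE => -[].
rewrite -(card_imset _ F_inj); apply: eq_card => h; apply/imsetP/idP.
  move=> [[f g]]; rewrite !inE /= => /andP[/andP[/forallP fw fa] /andP[/forallP gw gb]] ->.
  apply/and3P; split.
  - by apply/forallP => x; rewrite !ffunE /= (eqP (fw x)) (eqP (gw x)).
  - apply/forallP => i; rewrite -(eqP (forallP fa i)); apply/eqP; congr Posz.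
    by apply: eq_card => x; rewrite !inE ffunE.
  - apply/forallP => i; rewrite -(eqP (forallP gb i)); apply/eqP; congr Posz.
    by apply: eq_card => x; rewrite !inE ffunE.
rewrite !inE => /and3P[/forallP hw /forallP ha /forallP hb].
exists ([ffun x => (h x).1], [ffun x => (h x).2]); last first.
  by apply/ffunP => x; rewrite !ffunE /=; case: (h x).
rewrite !inE /=; apply/andP; split; apply/andP; split; apply/forallP => x.
- by rewrite !ffunE (eqP (hw x)).
- rewrite -(eqP (ha x)); apply/eqP; congr Posz.
  by apply: eq_card => y; rewrite !inE ffunE.
- by rewrite !ffunE (eqP (hw x)).
rewrite -(eqP (hb x)); apply/eqP; congr Posz.
by apply: eq_card => y; rewrite !inE ffunE.
Qed.

Lemma sum_fixed_pair_colorings n p l (a : 'I_p -> int) (b : 'I_l -> int) :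
  (\sum_(w : 'S_n) #|fixed_colorings _ w :&: pair_colorings n a b|)%N =
  (#|orbit (recolor_action _ _) setT @: pair_colorings n a b| * n`!)%N.
Proof.
rewrite -(card_Sn n) -(cardsT 'S_n) -Frobenius_Cauchy; last first.
  (* Burnside's lemma needs an action on this set: its conditions involve only color counts, which
     recoloring preserves. *)
  apply/actsP => s _ h; rewrite !inE.
  congr andb; apply: eq_forallb => i; congr (Posz _ == _).
    rewrite !color_count_fst; apply: eq_bigr => z _; exact: color_count_recolor.
  rewrite !color_count_snd; apply: eq_bigr => z _; exact: color_count_recolor.
apply: eq_big => [w|w _]; first by rewrite inE.
apply: eq_card => h.
rewrite !inE sub1set inE /= recolor_fix andbC.
by [].
Qed.

(** On [S] the map [F] factors through [G]. The factor is defined by picking a preimage, with [None]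
    off the image of [G]. *)
Lemma leq_card_imset_fibres (T U V : finType) (S : {set T}) (F : T -> U) (G : T -> V) :
  {in S &, forall x y, G x = G y -> F x = F y} -> (#|F @: S| <= #|G @: S|)%N.
Proof.
move=> GF; pose pre v := [pick x in S | G x == v].
have someI : injective (@Some U) by move=> x y [].
rewrite -(card_imset _ someI).
apply: leq_trans (leq_imset_card (fun v => omap F (pre v)) _).
apply/subset_leq_card/subsetP => _ /imsetP[_ /imsetP[x xS ->] ->].
apply/imsetP; exists (G x); first exact: imset_f.
rewrite /pre; case: pickP => [y /andP[yS /eqP yx]|/(_ x)] /=.
  by rewrite (GF y x).
by rewrite xS eqxx.
Qed.

Lemma eq_card_imset_fibres (T U V : finType) (S : {set T}) (F : T -> U) (G : T -> V) :
  {in S &, forall x y, (F x == F y) = (G x == G y)} -> #|F @: S| = #|G @: S|.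
Proof.
move=> FG; apply/eqP; rewrite eqn_leq; apply/andP; split;
  apply: leq_card_imset_fibres => x y xS yS /eqP e; apply/eqP.
  by rewrite FG.
by rewrite -FG.
Qed.

(** * Overlap matrices of pairs of colorings *)

Section Overlap.
Variables (n p l D : nat) (a : 'I_p -> int) (b : 'I_l -> int).
Hypothesis a_le : forall i, a i <= D%:Z.

Let S := pair_colorings n a b.
Let cell (h : {ffun 'I_n -> 'I_p.+1 * 'I_l.+1}) (i : 'I_p) (j : 'I_l) : int :=
  (color_count h (lift ord0 i, lift ord0 j))%:Z.

(** The inner cells and the prescribed margins determine row 0 and column 0, and the total n then
    determines the corner. Hence the inner cells determine the orbit. *)
Lemma pair_coloring_counts h : h \in S ->
  [/\ forall i, (color_count h (lift ord0 i, ord0))%:Z = a i - \sum_j cell h i j,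
      forall j, (color_count h (ord0, lift ord0 j))%:Z = b j - \sum_i cell h i j &
      (color_count h (ord0, ord0))%:Z =
        n%:Z - \sum_i a i - \sum_j b j + \sum_i \sum_j cell h i j].
Proof.
rewrite inE => /andP[/forallP ha /forallP hb].
have rowE i : (color_count h (lift ord0 i, ord0))%:Z = a i - \sum_j cell h i j.
  rewrite -(eqP (ha i)) color_count_fst big_ord_recl PoszD.
  by rewrite (big_morph Posz PoszD erefl) addrK.
have colE j : (color_count h (ord0, lift ord0 j))%:Z = b j - \sum_i cell h i j.
  rewrite -(eqP (hb j)) color_count_snd big_ord_recl PoszD.
  by rewrite (big_morph Posz PoszD erefl) addrK.
split=> //; have := sum_color_count h; rewrite card_ord => /(congr1 Posz) <-.
rewrite (big_morph Posz PoszD erefl).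
rewrite -(pair_bigA _ (fun i j => (color_count h (i, j))%:Z)) /=.
have rowS i : \sum_j (color_count h (lift ord0 i, j))%:Z = a i.
  by rewrite big_ord_recl rowE addrNK.
rewrite big_ord_recl big_ord_recl (eq_bigr _ (fun j _ => colE j)) sumrB.
by rewrite (eq_bigr _ (fun i _ => rowS i)) [\sum_j \sum_i _]exchange_big /=; ring.
Qed.

(** Bounded entries make the matrices a finite type. On [S] an entry in row i is at most a_i <= D,
    so [inord] does not change it. *)
Definition overlap (h : {ffun 'I_n -> 'I_p.+1 * 'I_l.+1}) :
    {ffun 'I_p * 'I_l -> 'I_D.+1} :=
  [ffun ij => inord (color_count h (lift ord0 ij.1, lift ord0 ij.2))].

Lemma overlapE h i j : h \in S -> (overlap h (i, j) : nat)%:Z = cell h i j.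
Proof.
move=> hS; rewrite ffunE inordK // ltnS.
have [rowE _ _] := pair_coloring_counts hS.
have := rowE i; rewrite (bigD1 j) //= => cE.
have rest0 : 0 <= \sum_(k | k != j) cell h i k by apply: sumr_ge0.
move: cE rest0 (a_le i); rewrite {1}/cell; move: (\sum_(k | _) _) => R. lia.
Qed.

(** The three conditions say that the cells forced by [B] in column 0, in row 0 and in the corner
    are nonnegative. *)
Definition admissible (B : {ffun 'I_p * 'I_l -> 'I_D.+1}) : bool :=
  [&& [forall i, \sum_j (B (i, j) : nat)%:Z <= a i],
      [forall j, \sum_i (B (i, j) : nat)%:Z <= b j] &
      \sum_i a i + \sum_j b j - \sum_i \sum_j (B (i, j) : nat)%:Z <= n%:Z].

Lemma overlap_admissible h : h \in S -> admissible (overlap h).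
Proof.
move=> hS; have [rowE colE eE] := pair_coloring_counts hS.
have sumE : \sum_i \sum_j (overlap h (i, j) : nat)%:Z = \sum_i \sum_j cell h i j.
  by apply: eq_bigr => i _; apply: eq_bigr => j _; rewrite overlapE.
apply/and3P; split; last by rewrite sumE; lia.
  apply/forallP => i; rewrite (eq_bigr (cell h i)); last by move=> j _; rewrite overlapE.
  by rewrite -subr_ge0 -rowE.
apply/forallP => j; rewrite (eq_bigr (fun i => cell h i j)); last by move=> i _; rewrite overlapE.
by rewrite -subr_ge0 -colE.
Qed.

Lemma admissible_overlap B : admissible B -> exists2 h, h \in S & overlap h = B.
Proof.
case/and3P=> /forallP Ba /forallP Bb Bn.
pose row i := \sum_j (B (i, j) : nat)%:Z; pose col j := \sum_i (B (i, j) : nat)%:Z.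
pose tot := \sum_i row i.
(* Border [B] with the forced cells; admissibility makes the absolute values harmless. *)
pose M (y : 'I_p.+1 * 'I_l.+1) : nat :=
  match unlift ord0 y.1, unlift ord0 y.2 with
  | Some i, Some j => B (i, j)
  | Some i, None => absz (a i - row i)%R
  | None, Some j => absz (b j - col j)%R
  | None, None => absz (n%:Z - (\sum_i a i + \sum_j b j - tot))%R
  end.
have MSS i j : (M (lift ord0 i, lift ord0 j))%:Z = (B (i, j) : nat)%:Z.
  by rewrite /M /= !liftK.
have MS0 i : (M (lift ord0 i, ord0))%:Z = a i - row i.
  by rewrite /M /= liftK unlift_none; have := Ba i; rewrite -/(row i); lia.
have M0S j : (M (ord0, lift ord0 j))%:Z = b j - col j.
  by rewrite /M /= liftK unlift_none; have := Bb j; rewrite -/(col j); lia.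
have M00 : (M (ord0, ord0))%:Z = n%:Z - (\sum_i a i + \sum_j b j - tot).
  by rewrite /M /= !unlift_none gez0_abs // subr_ge0; apply: Bn.
have rowM i : \sum_z (M (lift ord0 i, z))%:Z = a i.
  by rewrite big_ord_recl MS0 (eq_bigr _ (fun j _ => MSS i j)) subrK.
have colM j : \sum_z (M (z, lift ord0 j))%:Z = b j.
  by rewrite big_ord_recl M0S (eq_bigr _ (fun i _ => MSS i j)) subrK.
have sumM : (\sum_y M y)%N = n.
  apply: (can_inj absz_nat : injective Posz); rewrite (big_morph Posz PoszD erefl).
  rewrite (eq_bigr (fun y => (M (y.1, y.2))%:Z)); last by case.
  rewrite -(pair_bigA _ (fun i j => (M (i, j))%:Z)) /=.
  rewrite big_ord_recl (eq_bigr _ (fun i _ => rowM i)).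
  rewrite big_ord_recl M00 (eq_bigr _ (fun j _ => M0S j)) sumrB.
  by rewrite /tot /row /col exchange_big /=; ring.
have [h hM] := exists_coloring sumM; exists h.
  rewrite inE; apply/andP; split; apply/forallP => i.
    rewrite color_count_fst (big_morph Posz PoszD erefl) -(rowM i); apply/eqP.
    by apply: eq_bigr => j _; rewrite hM.
  rewrite color_count_snd (big_morph Posz PoszD erefl) -(colM i); apply/eqP.
  by apply: eq_bigr => j _; rewrite hM.
apply/ffunP => -[i j]; rewrite ffunE hM /M /= !liftK; exact: inord_val.
Qed.

Lemma card_orbits :
  #|orbit (recolor_action _ _) setT @: S| = #|[set B | admissible B]|.
Proof.
rewrite (@eq_card_imset_fibres _ _ _ _ _ overlap); last first.
  move=> h g hS gS; rewrite recolor_orbit; apply/forallP/eqP => [hg|hg y].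
    by apply/ffunP => ij; rewrite !ffunE (eqP (hg _)).
  have cellE i j : cell h i j = cell g i j by rewrite -!overlapE ?hg.
  have [rowh colh eh] := pair_coloring_counts hS.
  have [rowg colg eg] := pair_coloring_counts gS.
  rewrite -(inj_eq (can_inj absz_nat : injective Posz)); apply/eqP; case: y => i j.
  case: (unliftP ord0 i) => [i'|] ->; case: (unliftP ord0 j) => [j'|] ->.
  - exact: cellE.
  - by rewrite rowh rowg; congr (_ - _); apply: eq_bigr.
  - by rewrite colh colg; congr (_ - _); apply: eq_bigr.
  rewrite eh eg; congr (_ + _); apply: eq_bigr => k _; exact: eq_bigr.
apply: eq_card => B; rewrite inE; apply/imsetP/idP => [[h hS ->]|].
  exact: overlap_admissible.
by case/admissible_overlap => h hS <-; exists h.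
Qed.

End Overlap.

(* Burnside's lemma: the orbits of [S_n] on pairs of block colorings are
   classified by the sizes of the pairwise intersections of blocks. *)
Lemma sum_perm_char_headed n p l D (a : 'I_p -> int) (b : 'I_l -> int) :
  (forall i, a i <= D%:Z) ->
  (\sum_(w : 'S_n) perm_char (headed (n%:Z - \sum_i a i) a) (ctype w) *
     perm_char (headed (n%:Z - \sum_j b j) b) (ctype w))%N =
  (#|[set B : {ffun 'I_p * 'I_l -> 'I_D.+1} | admissible n a b B]| * n`!)%N.
Proof.
move=> aD; rewrite -card_orbits // -sum_fixed_pair_colorings.
by apply: eq_bigr => w _; rewrite !perm_char_headed fixed_pair_colorings.
Qed.

(** * Induction from Young subgroups *)

Lemma card_young_set n m : (m <= n)%N -> #|young_set n m| = m.
Proof.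
by move=> mn; rewrite -sum1dep_card (big_ord_narrow mn) big_const_ord iter_addn mul1n addn0.
Qed.

(** The indicator functions are two-colorings with equal color counts, hence lie in one orbit. *)
Lemma exists_perm_imset n (A B : {set 'I_n}) : #|A| = #|B| ->
  exists s : 'S_n, s @: A = B.
Proof.
move=> AB; pose ind (X : {set 'I_n}) := [ffun x => x \in X].
have cT (X : {set 'I_n}) : color_count (ind X) true = #|X|.
  by apply: eq_card => x; rewrite inE ffunE eqb_id.
have cF (X : {set 'I_n}) : color_count (ind X) false = #|~: X|.
  by apply: eq_card => x; rewrite !inE ffunE eqbF_neg.
have : orbit (recolor_action _ _) setT (ind B) == orbit (recolor_action _ _) setT (ind A).
  rewrite recolor_orbit; apply/forallP => -[]; rewrite ?cT ?cF ?AB //.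
  by rewrite [#|~: B|]cardsCs [#|~: A|]cardsCs !setCK AB.
rewrite orbit_eq_mem => /orbitP[s _ sE]; exists s; apply/setP => x.
have := congr1 (fun f : {ffun 'I_n -> bool} => f x) sE; rewrite /= !ffunE => <-.
by rewrite -{1}[x](permKV s) (mem_imset _ _ (@perm_inj _ s)).
Qed.

(** These permutations form a coset of the Young subgroup. *)
Lemma card_perm_imset n m (A : {set 'I_n}) : (m <= n)%N -> #|A| = m ->
  #|[set s : 'S_n | s @: A == young_set n m]| = #|young_sub n m|.
Proof.
move=> mn Am; have [s sA] : exists s : 'S_n, s @: A = young_set n m.
  by apply: exists_perm_imset; rewrite card_young_set.
rewrite -[RHS](card_imset _ (mulgI s)); apply: eq_card => t.
have imM (u v : 'S_n) (X : {set 'I_n}) : (u * v)%g @: X = v @: (u @: X).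
  by rewrite -imset_comp; apply: eq_imset => x; rewrite permM.
rewrite inE; apply/eqP/imsetP => [tA|[u + ->]].
  exists (s^-1 * t)%g; last by rewrite mulKVg.
  by rewrite inE -{1}sA -imM mulKVg tA.
by rewrite inE imM sA => /eqP.
Qed.

Lemma young_sub_stable n m (v : 'S_n) : v \in young_sub n m ->
  forall x, (v x \in young_set n m) = (x \in young_set n m).
Proof.
by rewrite inE => /eqP vY x; rewrite -{1}vY (mem_imset _ _ (@perm_inj _ v)).
Qed.

Definition colored p n (f : {ffun 'I_n -> 'I_p.+1}) : {set 'I_n} :=
  [set x | f x != ord0].

(** The set of points not colored [ord0] is stable under [v] for an invariant coloring. So both
    sides vanish when [v] moves the Young set; otherwise only the colors inside it are free. *)
Lemma perm_char_young n m p (a : 'I_p -> int) (v : 'S_n) :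
  (if v \in young_sub n m then perm_char a (ctype_on v (young_set n m)) else 0%N) =
  #|[set f in fixed_colorings _ v :&: block_colorings _ a | colored f == young_set n m]|.
Proof.
case: ifP => vY; last first.
  apply/esym/eqP; rewrite cards_eq0 -subset0; apply/subsetP => f.
  rewrite !inE => /andP[/andP[/forallP fv _] /eqP fY].
  move/negP: vY; case; rewrite inE eqEcard card_imset ?leqnn ?andbT; last exact: perm_inj.
  apply/subsetP => _ /imsetP[x + ->].
  by rewrite -fY !inE (eqP (fv x)).
rewrite (perm_char_color (young_sub_stable vY) _ ord0 (@lift_inj _ ord0)).
apply: eq_card => f; rewrite !inE -andbA; congr andb.
apply/andP/andP => [[/forallP fY /forallP fa]|[/forallP fa /eqP fY]].
  have fE : colored f = young_set n m.
    apply/setP => x; rewrite [LHS]inE; have := fY x; case: ifP => _ => [/codomP[i ->] //|->].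
    by [].
  split; last by rewrite fE.
  apply/forallP => i; rewrite -(eqP (fa i)); apply/eqP; congr Posz.
  apply: eq_card => x; rewrite [LHS]inE [RHS]inE -fE inE.
  by case: eqP => [->|]; rewrite ?andbF.
split.
  apply/forallP => x; rewrite -fY inE; case: (unliftP ord0 (f x)) => [j|] -> /=; first exact: codom_f.
  by [].
apply/forallP => i; rewrite -(eqP (fa i)); apply/eqP; congr Posz; apply: eq_card => x.
by rewrite -fY !inE; case: eqP => [->|]; rewrite ?andbF.
Qed.

Lemma card_colored n p (a : 'I_p -> int) (f : {ffun 'I_n -> 'I_p.+1}) :
  f \in block_colorings _ a -> (#|colored f|)%:Z = \sum_i a i.
Proof.
rewrite inE => /forallP fa; rewrite -(eq_bigr _ (fun i _ => eqP (fa i))).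
rewrite -(big_morph Posz PoszD erefl); congr Posz.
rewrite -sum1dep_card (partition_big f (fun y => y != ord0)) //=.
rewrite big_mkcond big_ord_recl /= add0n; apply: eq_bigr => i _.
rewrite sum1dep_card; apply: eq_card => x; rewrite !inE.
by case: eqP => [->|]; rewrite ?andbF.
Qed.

(** Recoloring by [x] carries the colorings fixed by [w] to those fixed by [w ^ x] and moves the
    colored set by [x]. After exchanging the sums, each coloring, whose colored set has [m] points,
    is met by as many [x] as the Young subgroup has elements. *)
Lemma sum_perm_char_young n m p (a : 'I_p -> int) (w : 'S_n) :
  (m <= n)%N -> \sum_i a i = m%:Z ->
  (\sum_(x : 'S_n) (if (w ^ x)%g \in young_sub n m
      then perm_char a (ctype_on (w ^ x)%g (young_set n m)) else 0) =
   #|young_sub n m| * #|fixed_colorings _ w :&: block_colorings _ a|)%N.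
Proof.
move=> mn am; set W := fixed_colorings _ w :&: _.
have conjE (x : 'S_n) :
   #|[set f in fixed_colorings _ (w ^ x)%g :&: block_colorings _ a
       | colored f == young_set n m]| =
   (\sum_(g in W) (x @: colored g == young_set n m))%N.
  rewrite -big_mkcondr sum1dep_card.
  have rI : injective (fun f : {ffun 'I_n -> 'I_p.+1} => recolor f (x^-1)%g).
    by apply: (can_inj (g := fun f => recolor f x)) => f; rewrite -recolorM mulVg recolor1.
  rewrite -(card_imset _ rI); apply: eq_card => g.
  have fixE f : (recolor f (x^-1)%g \in fixed_colorings _ w) =
                (f \in fixed_colorings _ (w ^ x)%g).
    rewrite !inE; apply/forallP/forallP => fw y.
      have := fw ((x^-1)%g y); rewrite !ffunE !invgK permKV.
      by rewrite conjgE !permM.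
    by have := fw (x y); rewrite !ffunE !invgK conjgE !permM permK.
  have blockE f : (recolor f (x^-1)%g \in block_colorings _ a) = (f \in block_colorings _ a).
    by rewrite !inE; apply: eq_forallb => i; rewrite color_count_recolor.
  have colE f : x @: colored (recolor f (x^-1)%g) = colored f.
    apply/setP => y; rewrite -{1}[y](permKV x) (mem_imset _ _ (@perm_inj _ x)).
    by rewrite !inE ffunE invgK permKV.
  have memE f :
      (recolor f (x^-1)%g \in [set g | (g \in W) && (x @: colored g == young_set n m)]) =
      (f \in [set f in fixed_colorings _ (w ^ x)%g :&: block_colorings _ a
                | colored f == young_set n m]).
    by rewrite [LHS]in_set [RHS]in_set !in_setI fixE blockE colE.
  apply/imsetP/idP => [[f + ->]|]; first by rewrite memE.
  exists (recolor g x); last by rewrite -recolorM mulgV recolor1.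
  have gE : g = recolor (recolor g x) (x^-1)%g by rewrite -recolorM mulgV recolor1.
  by rewrite -memE -gE.
under eq_bigr => x _ do rewrite perm_char_young conjE.
rewrite exchange_big /= mulnC -sum_nat_const; apply: eq_bigr => g.
rewrite inE => /andP[_ ga]; rewrite -big_mkcond sum1dep_card card_perm_imset //.
by have := card_colored ga; rewrite am => -[].
Qed.

(** * Vanishing of the alternating sum *)

(** Induction adds one block of size n - |mu| to each Jacobi-Trudi composition; the size is the same
    for all [s] because the shifts cancel. *)
Lemma Mn_headed mu n (w : 'S_n) : (sumn mu <= n)%N ->
  Mn mu w = \sum_(s : 'S_(size mu)) (-1) ^+ s *
    (perm_char (headed (n%:Z - \sum_i jt_index s i) (jt_index s)) (ctype w))%:R.
Proof.
move=> mun; rewrite /Mn mun.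
have Y0 : (#|young_sub n (sumn mu)|%:R : rat) != 0.
  rewrite pnatr_eq0 -lt0n; apply/card_gt0P; exists 1%g; rewrite inE.
  by apply/eqP/setP => x; rewrite -{1}[x]perm1 (mem_imset _ _ (@perm_inj _ 1%g)).
have -> : \sum_(x : 'S_n) (if (w ^ x)%g \in young_sub n (sumn mu)
     then (irr_char mu (ctype_on (w ^ x)%g (young_set n (sumn mu))))%:~R else 0) =
   \sum_(s : 'S_(size mu)) (-1) ^+ s * (\sum_(x : 'S_n)
     (if (w ^ x)%g \in young_sub n (sumn mu)
      then perm_char (jt_index s) (ctype_on (w ^ x)%g (young_set n (sumn mu)))
      else 0%N))%:R :> rat.
  under [RHS]eq_bigr => s _ do rewrite natr_sum mulr_sumr.
  rewrite exchange_big /=; apply: eq_bigr => x _; case: ifP => _.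
    exact: irr_charE.
  by rewrite big1 // => s _; rewrite mulr0.
rewrite mulr_sumr; apply: eq_bigr => s _.
rewrite sum_perm_char_young ?sum_jt_index // -[in RHS](sum_jt_index s) perm_char_headed.
by rewrite natrM mulrCA mulKf.
Qed.

(* Subtracting adjacent columns turns the step rows [e_j <= i] into indicators
   of [i = e_j], except in column 0. *)
Lemma det_step_eq0 l (e : 'I_l.+1 -> int) :
  (forall j, \sum_i e i - \sum_(i < l.+1) (i : nat)%:Z != e j) ->
  \det (\matrix_(j < l.+1, i < l.+1) (e j <= (i : nat)%:Z)%R%:R : 'M[rat]_l.+1) = 0.
Proof.
move=> esum.
(* Multiplication by the triangular matrix [U] of ones takes partial sums along the rows of [J],
   which recovers the steps. *)
pose J := \matrix_(j < l.+1, i < l.+1)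
  (if i == ord0 then (e j <= 0)%R%:R else (e j == (i : nat)%:Z)%:R) : 'M[rat]_l.+1.
pose U := \matrix_(k < l.+1, i < l.+1) (k <= i)%:R : 'M[rat]_l.+1.
have -> : \matrix_(j < l.+1, i < l.+1) (e j <= (i : nat)%:Z)%R%:R = J *m U.
  apply/matrixP => j i; rewrite !mxE big_ord_recl !mxE eqxx mulr1.
  have termE (k : 'I_l) : J j (lift ord0 k) * U (lift ord0 k) i =
      if e j == k.+1%:Z then (e j <= (i : nat)%:Z)%R%:R else 0.
    rewrite !mxE /= -[bump 0 k]/(k.+1).
    by case: eqP => [->|_]; rewrite ?mul0r ?mul1r ?lez_nat.
  rewrite (eq_bigr _ (fun k _ => termE k)).
  have [ej|ej] := lerP (e j) 0.
    rewrite big1 ?addr0 => [|k _]; last by case: eqP => //; lia.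
    by have -> : e j <= (i : nat)%:Z by apply: le_trans ej _.
  have [ejl|ejl] := leqP `|e j| l.
    have kl : (`|e j|.-1 < l)%N by lia.
    rewrite add0r (bigD1 (Ordinal kl)) //= ifT; last by apply/eqP; lia.
    rewrite big1 ?addr0 // => k kk; case: eqP => // ek; case/eqP: kk.
    by apply: val_inj => /=; rewrite ek.
  rewrite add0r big1 => [|k _]; last by case: eqP => // ek; have := ltn_ord k; lia.
  by have -> : (e j <= (i : nat)%:Z) = false by have := ltn_ord i; lia.
rewrite det_mulmx; apply/eqP; rewrite mulf_eq0; apply/orP; left; apply/eqP.
rewrite /determinant big1 // => s _.
have [|] := boolP [forall j, J j (s j) != 0]; last first.
  rewrite negb_forall => /existsP[j]; rewrite negbK => /eqP j0.
  by rewrite (bigD1 j) //= j0 mul0r mulr0.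
(* If the product for [s] were nonzero, e_j = s(j) would hold at every row except the one sent to
   column 0. The sum of all e_j minus that of all indices would then be the remaining e_j, against
   [esum]. *)
move=> /forallP Js; exfalso.
pose j0 := (s^-1)%g ord0; have sj0 : s j0 = ord0 by rewrite permKV.
have ej j : j != j0 -> e j = (s j : nat)%:Z.
  move=> jj0; have := Js j; rewrite mxE -{1}sj0 (inj_eq perm_inj) (negPf jj0).
  by case: (e j =P _) => // _; rewrite eqxx.
have : \sum_i e i - \sum_(i < l.+1) (i : nat)%:Z = e j0.
  rewrite [X in _ - X](reindex_inj (@perm_inj _ s)) (bigD1 j0) //= (bigD1 j0 (F := e)) //=.
  by rewrite (eq_bigr _ ej) sj0 add0r addrK.
by apply/eqP/esum.
Qed.

Definition blocks_fit (mu : seq nat) (c : 'I_(size mu) -> int) (s : 'S_(size mu)) : bool :=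
  [forall j, c j <= jt_index s j].

(** With e_j = c_j + j - mu_j, the condition on row j reads e_j <= s(j), so the sum is the
    determinant of [det_step_eq0]. The difference excluded there equals the sum of the c_j minus
    |mu|, which is below -mu_1, whereas every e_j is at least -mu_1. *)
Lemma signed_fit_eq0 (mu : seq nat) (c : 'I_(size mu) -> int) :
  sorted geq mu -> (forall j, 0 <= c j) ->
  (head 0%N mu)%:Z < (sumn mu)%:Z - \sum_j c j ->
  \sum_(s : 'S_(size mu)) (-1) ^+ s * (blocks_fit c s)%:R = 0 :> rat.
Proof.
case: mu c => [|x mu] c srt c0 hd; first by rewrite big_ord0 in hd.
pose e (j : 'I_(size mu).+1) : int := c j + (j : nat)%:Z - (nth 0%N (x :: mu) j)%:Z.
have sum_mu : \sum_(j < (size mu).+1) (nth 0%N (x :: mu) j)%:Z = (sumn (x :: mu))%:Z.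
  by rewrite sumnE (big_morph Posz PoszD erefl) (big_nth 0%N) big_mkord.
have sum_e : \sum_j e j - \sum_(i < (size mu).+1) (i : nat)%:Z =
    \sum_j c j - (sumn (x :: mu))%:Z.
  by rewrite sumrB big_split /= -sum_mu; ring.
have mono (j : 'I_(size mu).+1) : (nth 0%N (x :: mu) j)%:Z - (j : nat)%:Z <= x%:Z.
  case: (posnP j) => [->|j0] /=; first by rewrite subr0.
  have := @sorted_shift_decr (x :: mu) 0 j srt; rewrite j0 ltn_ord /= => /(_ isT); lia.
rewrite -[RHS](@det_step_eq0 _ e); last first.
  move=> j; rewrite sum_e; apply/eqP; have := mono j; have := c0 j.
  rewrite /e /= in hd *; lia.
apply: eq_bigr => s _; congr (_ * _); rewrite (eq_bigr (fun j => (e j <= (s j : nat)%:Z)%R%:R)); last first.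
  by move=> j _; rewrite mxE.
have fitE j : (c j <= @jt_index (x :: mu) s j) = (e j <= (s j : nat)%:Z).
  by rewrite /jt_index /e /=; lia.
have [/forallP fit|] := boolP (blocks_fit c s).
  by rewrite big1 // => j _; rewrite -fitE fit.
rewrite negb_forall => /existsP[j fj]; rewrite (bigD1 j) //= -fitE (negPf fj).
by rewrite mul0r.
Qed.

(** * Stable inner products *)

Section StableValue.
Variables (b mu : seq nat).

Let row (i : 'I_(size b)) : int := (nth 0%N b i)%:Z.
Local Notation matrices := {ffun 'I_(size b) * 'I_(size mu) -> 'I_(sumn b).+1}.

Definition rows_fit (B : matrices) : bool :=
  [forall i, \sum_j (B (i, j) : nat)%:Z <= row i].

Definition col_sum (B : matrices) (j : 'I_(size mu)) : int :=
  \sum_i (B (i, j) : nat)%:Z.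

(** The signed count of admissible matrices with the corner condition, the only one that mentions n,
    removed. *)
Definition stable_value : rat :=
  \sum_(B : matrices | rows_fit B)
    \sum_(s : 'S_(size mu)) (-1) ^+ s * (blocks_fit (col_sum B) s)%:R.

Let sum_row : \sum_i row i = (sumn b)%:Z.
Proof.
by rewrite sumnE (big_morph Posz PoszD erefl) (big_nth 0%N) big_mkord.
Qed.

Let row_le i : row i <= (sumn b)%:Z.
Proof. by rewrite -sum_row (bigD1 i) //= lerDl sumr_ge0. Qed.

Let sum_col_le B : rows_fit B -> \sum_j col_sum B j <= (sumn b)%:Z.
Proof.
move=> /forallP rB; rewrite -sum_row exchange_big /=; apply: ler_sum => i _.
exact: rB.
Qed.

Lemma pack_headed n (w : 'S_n) :
  pack b (ctype w) = (perm_char (headed (n%:Z - \sum_i row i) row) (ctype w))%:R.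
Proof.
have := packings_perm_char row (ctype w); rewrite sumn_ctype => <-.
rewrite /pack; congr packings.
apply: (@eq_from_nth _ 0); rewrite size_map ?size_image_ord // => i ib.
by rewrite (nth_map 0%N) // -[i in RHS]/(nat_of_ord (Ordinal ib)) nth_image_ord.
Qed.

Lemma cfdot_pack_Mn n : sorted geq mu -> (sumn b + head 0 mu <= n)%N ->
  cfdotS (fun w : 'S_n => pack b (ctype w)) (Mn mu (n := n)) = stable_value.
Proof.
move=> srt bn; rewrite /cfdotS.
(* If the corner condition fails, |mu| minus the total of [B] exceeds n - |b|, which is at least
   mu_1. *)
have fit0 B : rows_fit B -> n%:Z < (sumn b)%:Z + (sumn mu)%:Z - \sum_j col_sum B j ->
    \sum_(s : 'S_(size mu)) (-1) ^+ s * (blocks_fit (col_sum B) s)%:R = 0 :> rat.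
  move=> rB nB; apply: signed_fit_eq0 => // [j|]; first exact: sumr_ge0.
  lia.
(* For n < |mu| the function [Mn] is 0 by definition. The stable value is 0 as well: the total of
   [B] is at most |b|, so the corner condition fails for every [B]. *)
have [mun|mun] := leqP (sumn mu) n; last first.
  rewrite big1 ?mulr0; last by move=> w _; rewrite /Mn leqNgt mun mulr0.
  rewrite /stable_value big1 // => B rB; apply: fit0 => //.
  have := sum_col_le rB; lia.
have nf0 : (n`!)%:R != 0 :> rat by rewrite pnatr_eq0 -lt0n fact_gt0.
have -> : \sum_(w : 'S_n) pack b (ctype w) * Mn mu w =
   \sum_(s : 'S_(size mu)) (-1) ^+ s *
     (#|[set B : matrices | admissible n row (jt_index s) B]| * n`!)%:R.
  under eq_bigr => w _ do rewrite Mn_headed // pack_headed mulr_sumr.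
  rewrite exchange_big /=; apply: eq_bigr => s _.
  rewrite -sum_perm_char_headed // natr_sum mulr_sumr; apply: eq_bigr => w _.
  by rewrite natrM mulrCA.
under eq_bigr => s _ do rewrite natrM mulrA.
rewrite -mulr_suml mulrC mulfK // /stable_value [RHS]big_mkcond.
have cardE s : #|[set B : matrices | admissible n row (jt_index s) B]|%:R =
    \sum_(B : matrices) (admissible n row (jt_index s) B)%:R :> rat.
  rewrite -sum1_card natr_sum big_mkcond; apply: eq_bigr => B _.
  by rewrite inE; case: admissible.
under [LHS]eq_bigr => s _ do rewrite cardE mulr_sumr.
rewrite exchange_big /=; apply: eq_bigr => B _.
have sumB : \sum_i \sum_j (B (i, j) : nat)%:Z = \sum_j col_sum B j.
  by rewrite exchange_big.
have admE s : admissible n row (jt_index s) B =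
    [&& rows_fit B, blocks_fit (col_sum B) s &
        (sumn b)%:Z + (sumn mu)%:Z - \sum_j col_sum B j <= n%:Z].
  by rewrite /admissible sum_row sum_jt_index sumB.
under eq_bigr => s _ do rewrite admE.
case: (boolP (rows_fit B)) => rB /=; last by rewrite big1 // => s _; rewrite mulr0.
case: (lerP (_ - _) n%:Z) => [_|nB]; last first.
  by rewrite fit0 // big1 // => s _; rewrite andbF mulr0.
by apply: eq_bigr => s _; rewrite andbT.
Qed.
End StableValue.

Lemma cfdot_chiP_Mn_stable K (P : ratpoly K) (S : seq (seq nat))
    (c : seq nat -> int) (b : nat) :
  (forall mu, mu \in S -> is_partition mu) ->
  (forall mu, mu \in S -> c mu != 0 -> (head 0%N mu <= b)%N) ->
  exists C : rat, forall n : nat, (qdeg P + b <= n)%N ->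
    cfdotS (@chiP K P n) (Mn_lin S c (n:=n)) = C.
Proof.
move=> S_part S_head; have [L /allP DL eL] := ratpoly_pack_span P.
exists (\sum_(t <- L) \sum_(mu <- S) t.1 * (c mu)%:~R * stable_value t.2 mu).
move=> n nb; rewrite /cfdotS.
have -> : \sum_(w : 'S_n) chiP P w * Mn_lin S c w =
    \sum_(t <- L) \sum_(mu <- S) t.1 * (c mu)%:~R *
      \sum_(w : 'S_n) pack t.2 (ctype w) * Mn mu w.
  under [RHS]eq_bigr => t _.
    under eq_bigr => mu _ do rewrite mulr_sumr.
    rewrite exchange_big /=; over.
  rewrite exchange_big /=; apply: eq_bigr => w _.
  rewrite chiP_ctype eL ?ctype_gt0 // mulr_suml; apply: eq_bigr => t _.
  by rewrite /Mn_lin mulr_sumr; apply: eq_bigr => mu _; ring.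
rewrite mulr_sumr big_seq [RHS]big_seq; apply: eq_bigr => t tL.
rewrite mulr_sumr big_seq [RHS]big_seq; apply: eq_bigr => mu muS.
(* The bound [b] on the first part is available only when the coefficient is nonzero; the other
   terms vanish on both sides. *)
have [->|cmu] := eqVneq (c mu) 0; first by rewrite mulr0 !mul0r mulr0.
rewrite mulrCA -(@cfdot_pack_Mn t.2 mu n) //.
  by case/andP: (S_part _ muS).
have := S_head _ muS cmu; have := DL _ tL => /=; lia.
Qed.

Theorem mainTheorem12 (K : nat) (P : ratpoly K) :
  (exists (S : seq (seq nat)) (d : seq nat -> rat),
     [/\ uniq S,
         (forall nu, nu \in S -> is_partition nu /\ (sumn nu <= qdeg P)%N) &
         forall n : nat, (2 * qdeg P <= n)%N ->
           forall w : {perm 'I_n},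
             chiP P w = \sum_(nu <- S) d nu * chi ((n - sumn nu)%N :: nu) w])
  /\
  (forall (S : seq (seq nat)) (c : seq nat -> int) (b : nat),
     uniq S ->
     (forall mu, mu \in S -> is_partition mu) ->
     (forall mu, mu \in S -> c mu != 0 -> (head 0%N mu <= b)%N) ->
     exists C : rat, forall n : nat,
       (maxn (2 * qdeg P) (qdeg P + b) <= n)%N ->
       cfdotS (@chiP K P n) (Mn_lin S c (n:=n)) = C).
Proof.
split; first exact: chiP_decomposition.
move=> S c b _ S_part S_head.
have [C CE] := cfdot_chiP_Mn_stable P S_part S_head; exists C => n nP.
by apply: CE; apply: leq_trans nP; apply: leq_maxr.
Qed.
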